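(* Let $K$ be a locally compact abelian group and let $G$ be a non-discrete, locally essential subgroup of $K$. Then $G$ contains a super-sequence $S$ converging to $0$ such that $|S|=\chi(K)$. In particular, $\mathfrak{s}(G)=\chi(G)^+$.
   Context: All topological groups are Hausdorff; subgroups carry the subspace topology. $\chi(X)$ denotes the character of a space $X$; by convention all cardinal invariants take infinite values (i.e. they are replaced by $\omega$ whenever they would be finite). $\kappa^+$ denotes the successor cardinal of $\kappa$. A subgroup $G$ of a topological group $H$ is called locally essential (in $H$) if there exists a neighborhood $V$ of $1$ in $H$ such that for every closed normal subgroup $N$ of $H$ contained in $V$, $G\cap N=\{1\}$ implies $N=\{1\}$. An infinite Hausdorff space $S$ is a convergent super-sequence if it has a single non-isolated point $x$ and every neighbourhood of $x$ contains all but finitely many points of $S$; then $S$ is said to converge to $x$. A super-sequence in a space $X$ is a subspace of $X$ that is a convergent super-sequence. For a topological space $X$, $\mathfrak{s}(X)=\min\{\kappa: X$ has no convergent super-sequence of size $\ge\kappa\}$ (with $\kappa$ ranging over infinite cardinals). *)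

(* Defs.v *)
From HB Require Import structures.
From mathcomp Require Import all_boot all_order all_algebra.
From mathcomp Require Import boolp classical_sets functions cardinality.
From mathcomp Require Import topology tvs.
Set Implicit Arguments.
Unset Strict Implicit.
Unset Printing Implicit Defensive.
Import GRing.Theory.
Local Open Scope classical_set_scope.
Local Open Scope card_scope.
Local Open Scope ring_scope.

(* Cardinal numbers are represented, up to equipotence [#=], by sets over      *)
(* arbitrary types.  A cardinal invariant is therefore a predicate on sets     *)
(* [A : set T], read "the invariant is equal to |A|".                          *)

Definition card_lt T U (A : set T) (B : set U) : Prop :=
  A #<= B /\ ~ (B #<= A).

Definition is_succ_card T U (A : set T) (B : set U) : Prop :=
  card_lt A B /\
  forall (V : Type) (C : set V), card_lt A C -> B #<= C.

(* |A| = min {k : k infinite and P k} *)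
Definition is_least_infinite_card (P : forall T, set T -> Prop)
    T (A : set T) : Prop :=
  [/\ infinite_set A, P T A &
      forall (U : Type) (B : set U), infinite_set B -> P U B -> A #<= B].

Definition local_basis (X : topologicalType) (x : X) (B : set (set X)) : Prop :=
  B `<=` open_nbhs x /\ filter_from B id --> x.

(* chi(X) = |A|: the supremum of the characters of the points of X is the      *)
(* least upper bound, taken here among infinite cardinals, so that finite      *)
(* values are replaced by omega.                                               *)
Definition is_character (X : topologicalType) T (A : set T) : Prop :=
  is_least_infinite_card
    (fun U (C : set U) =>
       forall x : X, exists2 B, local_basis x B & B #<= C) A.

Definition convergent_super_sequence (S : topologicalType) (x : S) : Prop :=
  [/\ infinite_set [set: S], hausdorff_space S,
      ~` isolated [set: S] = [set x] &
      forall V, nbhs x V -> finite_set (~` V)].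

(* A subset [S] is seen as a space through [set_type S], which carries the     *)
(* subspace topology.                                                          *)
Definition super_sequence_to (X : topologicalType) (S : set X) (x : X) : Prop :=
  exists2 y : S, convergent_super_sequence y & val y = x.

(* s(X) = |A| *)
Definition is_super_sequence_card (X : topologicalType) T (A : set T) : Prop :=
  is_least_infinite_card
    (fun U (C : set U) =>
       ~ exists (S : set X) (x : X), super_sequence_to S x /\ C #<= S) A.

Definition discrete_space (X : topologicalType) : Prop :=
  forall x : X, nbhs x = principal_filter x.

Definition subgroup (H : zmodType) (G : set H) : Prop := zmod_closed (mem G).

(* Every subgroup of the abelian group [H] is normal, so normality of [N] is   *)
(* not mentioned.                                                              *)
Definition locally_essential (H : topologicalZmodType) (G : set H) : Prop :=
  exists2 V : set H, nbhs (0 : H) V &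
    forall N : set H, subgroup N -> closed N -> N `<=` V ->
      G `&` N = [set 0] -> N = [set 0].

(* Main.v *)
Require Import Defs.
From HB Require Import structures.
From mathcomp Require Import all_boot all_order all_algebra.
From mathcomp Require Import ring lra zify.
From mathcomp Require Import boolp classical_sets functions cardinality wochoice.
From mathcomp Require Import reals Rstruct topology normedtype tvs urysohn.
Set Implicit Arguments.
Unset Strict Implicit.
Unset Printing Implicit Defensive.
Import Order.TTheory GRing.Theory Num.Theory numFieldNormedType.Exports.
From mathcomp.real_closed Require Import complex.
Local Open Scope classical_set_scope.
Local Open Scope card_scope.
Local Open Scope ring_scope.

(** Everything comes from one family [g i], [i] in [J], of nonzero elements of
[G] that tends to [0], in the sense that each neighbourhood of [0] contains all
but finitely many of them, and that is so long that [K] has a local basis at [0]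
of cardinality [max(|J|, omega)].  Its range together with [0] is the
super-sequence [S] ([null_family_super_sequence]).  Conversely a super-sequence
is never longer than a local basis at its limit, because every other point is
missed by a basic neighbourhood and each basic neighbourhood misses only finitely
many points ([super_sequence_card_le]); so [|S|] is the character of [K], and of
[G], in which [S] already lives.

The family is found inside a compact subgroup [N] of [K] that is contained in the
neighbourhood given by local essentiality and is the intersection of countably
many closed neighbourhoods of [0] ([small_compact_subgroup]).  Let [X] be the
group of continuous characters of [N].  As an abstract group, [X] embeds into the
finitely supported maps from an index set to a countable divisible subgroup of
the circle ([finite_support_embedding]).  The [i]-th coordinate of the embedding
is a homomorphism from [X] to the circle, hence the evaluation at some point of
[N] ([kronecker]).  Therefore the closed subgroup [M i] of the points of [N]
killed by all characters whose [i]-th coordinate vanishes is nonzero as soon as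
the coordinate is.  A single character has finite support, so it kills all but
finitely many of the [M i]; as characters determine the topology of [N], the
subgroups [M i] tend to [0] ([compact_null_subgroups]).  Local essentiality puts a
nonzero [g i] into each [G `&` M i].

For the size of the family, an element of [X] is coded by the finite list of its
nonzero coordinates, so [|X| <= max(|J|, omega)].  Since characters separate the
points of [N], this yields [max(|J|, omega)] closed neighbourhoods of [0] in [K]
with intersection [{0}], and by local compactness their finite intersections form
a local basis ([local_basis_of_closed_nbhs]).  If [J] is finite, [K] is first
countable and a sequence of nonzero elements of the non-discrete group [G] does
instead ([countable_null_family]).

The two facts of duality theory that enter are proved with an invariant mean on
the bounded functions on [N] ([invariant_mean_exists]).  Characters separate
points ([continuous_characters_separate]): translations act as commuting
isometries for the mean square norm, any finite number of them have a common
approximate eigenvector which a given convolution operator does not almost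
annihilate, and an ultralimit of the eigenvalues is a character, continuous
because convolution is smoothing.  Homomorphisms from [X] to the circle are
evaluations: sums of characters, rotated according to the homomorphism, can be
made to concentrate around the desired point, since their mean square norm just
counts coincidences between the summands ([nrm2_twisted_sum]). *)

(** * Cardinal arithmetic *)

(** With an injection given as a relation, the target type may be empty. *)
Lemma card_le_relP T U (A : set T) (B : set U) :
  A #<= B <-> exists R : T -> U -> Prop,
    (forall x, A x -> exists2 y, B y & R x y) /\
    (forall x x' y, R x y -> R x' y -> x = x').
Proof.
split=> [/card_leP[f]|[R [RA Rinj]]].
  exists (fun x y => exists2 a : A, val a = x & val (f a) = y); split.
    move=> x Ax; pose a : A := SigSub (mem_set Ax).
    by exists (val (f a)); [exact: set_valP|exists a].
  move=> x x' y [a <- <-] [a' <- /val_inj/esym faa'].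
  by have -> : a = a' by apply: (@inj _ _ _ f) => //; rewrite in_setT.
have /choice[f fP] (a : A) : exists b : B, R (val a) (val b).
  have [y By Rxy] := RA _ (set_valP a).
  by exists (SigSub (mem_set By)).
apply/card_leP; rewrite injfunPex; exists f => // a a' _ _ faa'.
by apply/val_inj/(Rinj _ _ (val (f a))) => //; rewrite faa'.
Qed.

Lemma card_le_inj T U (A : set T) (B : set U) (f : T -> U) :
  (forall x, A x -> B (f x)) ->
  (forall x y, A x -> A y -> f x = f y -> x = y) -> A #<= B.
Proof.
move=> fAB finj; apply/card_le_relP.
exists (fun x y => A x /\ y = f x); split=> [x Ax|x x' y [Ax ->] [Ax' /finj]].
  by exists (f x) => //; exact: fAB.
exact.
Qed.

Lemma card_le_fun T (U : Type) (A : set T) (B : set U) (u : U) : A #<= B ->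
  exists f : T -> U, (forall x, A x -> B (f x)) /\
    (forall x y, A x -> A y -> f x = f y -> x = y).
Proof.
move=> /card_le_relP[R [RA Rinj]].
have /choice[f fP] x : exists y, A x -> B y /\ R x y.
  by have [/RA[y By Rxy]|nAx] := pselect (A x); [exists y|exists u].
exists f; split=> [x /fP[]//|x y /fP[_ Rx] /fP[_ Ry] fxy].
by apply: Rinj Rx _; rewrite fxy.
Qed.

(** A maximal partial injection exhausts one of the two sets. *)
Lemma card_le_total T U (A : set T) (B : set U) : A #<= B \/ B #<= A.
Proof.
pose P (F : set (T * U)) := [/\ F `<=` A `*` B,
  forall x y y', F (x, y) -> F (x, y') -> y = y' &
  forall x x' y, F (x, y) -> F (x', y) -> x = x'].
have [F FP Ftot|F [[FAB Ffun Finj] Fmax]] := @Zorn_bigcup _ P.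
  split=> [z [X /FP[+ _ _]]|x y y' [X FX Xxy] [Y FY Yxy']|x x' y [X FX Xxy] [Y FY Yxy']].
  - exact.
  - have [XY|YX] := Ftot _ _ FX FY.
    + by have [_ + _] := FP _ FY; apply; [exact: XY Xxy|].
    + by have [_ + _] := FP _ FX; apply; [exact: Xxy|exact: YX].
  - have [XY|YX] := Ftot _ _ FX FY.
    + by have [_ _] := FP _ FY; apply; [exact: XY Xxy|].
    + by have [_ _] := FP _ FX; apply; [exact: Xxy|exact: YX].
have [[x [Ax nF]]|allA] := pselect (exists x, A x /\ forall y, ~ F (x, y)); last first.
  left; apply/card_le_relP; exists (fun x y => F (x, y)); split=> // x Ax.
  apply: contrapT => nF; apply: allA; exists x; split=> // y Fxy; apply: nF.
  by exists y => //; have [] := FAB _ Fxy.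
have [[y [By nFy]]|allB] := pselect (exists y, B y /\ forall x, ~ F (x, y)); last first.
  right; apply/card_le_relP; exists (fun y x => F (x, y)); split=> [y By|y y' z]; last exact: Ffun.
  apply: contrapT => nFy; apply: allB; exists y; split=> // z Fzy; apply: nFy.
  by exists z => //; have [] := FAB _ Fzy.
exfalso; apply: (Fmax (F `|` [set (x, y)])).
  split; first exact: subsetUl.
  by move=> /(_ (x, y)) sub; apply: (nF y); apply: sub; right.
split=> [z [/FAB//|->//]|a b b' [Fab|[ea eb]] [Fab'|[ea' eb']]|
  a a' b [Fab|[ea eb]] [Fab'|[ea' eb']]].
- exact: Ffun Fab Fab'.
- by subst; case: (nF b).
- by subst; case: (nF b').
- by subst.
- exact: Finj Fab Fab'.
- by subst; case: (nFy a).
- by subst; case: (nFy a').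
- by subst.
Qed.

Lemma card_le_setX T U T' U' (A : set T) (B : set U) (A' : set T') (B' : set U') :
  A #<= A' -> B #<= B' -> A `*` B #<= A' `*` B'.
Proof.
move=> /card_le_relP[R [RA Rinj]] /card_le_relP[S [SB Sinj]].
apply/card_le_relP; exists (fun p q => R p.1 q.1 /\ S p.2 q.2); split.
  move=> [x y] [/= /RA[x' ? ?] /SB[y' ? ?]]; by exists (x', y').
move=> [x y] [x' y'] [a b] [/= Rx Sx] [Rx' Sx'].
by rewrite (Rinj _ _ _ Rx Rx') (Sinj _ _ _ Sx Sx').
Qed.

Lemma card_le_setU T U (A B : set T) (C : set U) :
  infinite_set C -> C `*` C #<= C -> A #<= C -> B #<= C -> A `|` B #<= C.
Proof.
move=> Cinf CC AC BC; apply: card_le_trans CC.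
have /infiniteP Cnat := Cinf.
apply: (@card_le_trans _ _ _ ([set: nat] `*` C)); last first.
  exact: card_le_setX.
move: AC BC => /card_le_relP[R [RA Rinj]] /card_le_relP[S [SB Sinj]].
apply/card_le_relP.
exists (fun x q => q.1 = 0%N /\ R x q.2 \/ q.1 = 1%N /\ S x q.2); split.
  move=> x [/RA[y Cy Rxy]|/SB[y Cy Sxy]]; [exists (0%N, y)|exists (1%N, y)] => //.
    by left.
  by right.
move=> x x' [n y] /= [[-> ?] [[//]|[//]]|[-> ?] [[//]|[//]]]; first by move=> _; apply: Rinj.
by move=> _; apply: Sinj.
Qed.

(** Take a maximal injective map [B `*` B -> B] with [B `<=` A], given by its graph
[F].  If [A `\` B] is at most as large as [B], then so is [A].  Otherwise [A `\` B]
contains a copy of [B], into which the pairs of [B2 `*` B2] outside [B `*` B] can be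
injected, [B2] being the union of [B] and its copy; this contradicts maximality. *)
Lemma card_setX_le T (A : set T) : infinite_set A -> A `*` A #<= A.
Proof.
move=> Ainf.
have /infiniteP natA := Ainf.
pose dom (F : set (T * T * T)) : set T := [set x | exists y z, F ((x, y), z)].
pose P (F : set (T * T * T)) := [/\ forall x y z, F ((x, y), z) ->
    [/\ A x, dom F y & dom F z],
  forall x y, dom F x -> dom F y -> exists z, F ((x, y), z),
  forall p z z', F (p, z) -> F (p, z') -> z = z' &
  forall p p' z, F (p, z) -> F (p', z) -> p = p'].
have domS F F' : F `<=` F' -> dom F `<=` dom F'.
  by move=> FF x [y [z Fx]]; exists y, z; exact: FF.
(* A countable start, which keeps [B] infinite. *)
have [F0 PF0 F0inf] : exists2 F0, P F0 & infinite_set (dom F0).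
  have [t0 _] := infinite_setN0 Ainf.
  have [f [fA finj]] := card_le_fun t0 natA.
  pose k : nat * nat -> nat := pickle.
  have kinj : injective k by exact: pcan_inj pickleK.
  pose F0 : set (T * T * T) := [set p | exists i j, p = ((f i, f j), f (k (i, j)))].
  have dF0 i : dom F0 (f i) by exists (f i), (f (k (i, i))), i, i.
  exists F0; first split.
  - by move=> _ _ _ [i [j [-> -> ->]]]; split; [exact: fA| |].
  - move=> x y [_ [_ [i [_ [-> _ _]]]]] [_ [_ [j [_ [-> _ _]]]]].
    by exists (f (k (i, j))), i, j.
  - move=> [x y] z z' [i [j [-> -> ->]]] [i' [j' [ei ej ->]]].
    by rewrite (finj i i') // (finj j j').
  - move=> [x y] [x' y'] z [i [j [-> -> ->]]] [i' [j' [-> -> e]]].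
    by have /kinj[-> ->] := finj _ _ I I e.
  - apply/infiniteP; apply: (@card_le_inj _ _ _ _ f) => [i _|i j _ _]; first exact: dF0.
    exact: finj.
have [FF FFP FFtot|F1 [[]]] := @Zorn_bigcup _ (fun F => P (F0 `|` F)).
  have -> : F0 `|` \bigcup_(X in FF) X = \bigcup_(X in F0 |` [set F0 `|` X | X in FF]) X.
    apply/seteqP; split=> [p [F0p|[X FX Xp]]|p [Y [->|[X FX <-]]]].
    - by exists F0 => //; left.
    - by exists (F0 `|` X); [right; exists X|right].
    - by left.
    - by move=> [?|?]; [left|right; exists X].
  set GG := F0 |` _.
  have GP : GG `<=` P by move=> X [->//|[Y /FFP ? <-//]].
  have Gtot : total_on GG subset.
    move=> X Y [->|[X' FX <-]] [->|[Y' FY <-]].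
    - by left.
    - by left; exact: subsetUl.
    - by right; exact: subsetUl.
    - by have [?|?] := FFtot _ _ FX FY; [left|right]; exact: setUS.
  have Gdir X Y : GG X -> GG Y -> exists Z, [/\ GG Z, X `<=` Z & Y `<=` Z].
    move=> GX GY; have [XY|YX] := Gtot _ _ GX GY; first by exists Y; split.
    by exists X; split.
  have Gsub X : GG X -> X `<=` \bigcup_(X in GG) X by move=> GX p Xp; exists X.
  split.
  - move=> x y z [X GX Xp]; have [+ _ _ _] := GP _ GX => /(_ _ _ _ Xp)[? ? ?].
    by split=> //; apply: (domS _ _ (Gsub _ GX)).
  - move=> x y [x1 [x2 [X GX Xx]]] [y1 [y2 [Y GY Yy]]].
    have [Z [GZ XZ YZ]] := Gdir _ _ GX GY.
    have [_ + _ _] := GP _ GZ => /(_ x y)[||z Zz].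
    + by exists x1, x2; exact: XZ.
    + by exists y1, y2; exact: YZ.
    + by exists z; exists Z.
  - move=> p z z' [X GX Xp] [Y GY Yp]; have [Z [GZ XZ YZ]] := Gdir _ _ GX GY.
    by have [_ _ + _] := GP _ GZ => /(_ p z z'); apply; [exact: XZ|exact: YZ].
  - move=> p p' z [X GX Xp] [Y GY Yp]; have [Z [GZ XZ YZ]] := Gdir _ _ GX GY.
    by have [_ _ _] := GP _ GZ => /(_ p p' z); apply; [exact: XZ|exact: YZ].
set F := F0 `|` F1 => FA Fsq Ffun Finj Fmax.
set B := dom F in FA Fsq.
have BA : B `<=` A by move=> x [y [z /FA[]]].
have Binf : infinite_set B.
  by apply: sub_infinite_set F0inf; apply: domS; exact: subsetUl.
have BB : B `*` B #<= B.
  apply/card_le_relP; exists (fun p z => F (p, z)); split=> // -[x y] [/= Bx By].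
  by have [z Fz] := Fsq _ _ Bx By; exists z => //; have [] := FA _ _ _ Fz.
have AU : A = B `|` (A `\` B).
  apply/seteqP; split=> [x Ax|x [/BA|[]]//].
  by have [] := pselect (B x); [left|right].
have [DB|BD] := card_le_total (A `\` B) B.
  have AB : A #<= B by rewrite AU; apply: card_le_setU.
  apply: (card_le_trans (card_le_setX AB AB)); apply: (card_le_trans BB).
  exact: subset_card_le.
exfalso.
have [t0 _] := infinite_setN0 Ainf.
have [j [jD jinj]] := card_le_fun t0 BD.
pose B2 := B `|` j @` B.
have B2B : B2 #<= B.
  apply: card_le_setU => //; apply/card_le_relP.
  exists (fun x y => B y /\ x = j y); split=> [_ [x Bx <-]|x x' y [_ ->] [_ ->]//].
  by exists x.
have [k [kB kinj]] := card_le_fun t0 (card_le_trans (card_le_setX B2B B2B) BB).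
pose G : set (T * T * T) := [set p | (B2 `*` B2) p.1 /\ ~ (B `*` B) p.1 /\ p.2 = j (k p.1)].
have BBn x : B x -> ~ (j @` B) x by move=> Bx [y /jD[_ nB] jyx]; rewrite jyx in nB.
have domG : dom (F `|` G) = B2.
  apply/seteqP; split=> [x [y [z [Fp|[[]//]]]]|x B2x].
    by left; exists y, z.
  have [Bx|nBx] := pselect (B x); first by apply: domS Bx; exact: subsetUl.
  exists x, (j (k (x, x))); right; split=> //=; split=> //; by move=> [].
have GB p z : G (p, z) -> (j @` B) z.
  by move=> [B2p [_ /= ->]]; exists (k p) => //; exact: kB.
apply: (Fmax (F1 `|` G)).
  split; first exact: subsetUl.
  have [b Bb] := infinite_setN0 Binf => sub.
  have /sub F1p : (F1 `|` G) ((j b, j b), j (k (j b, j b))).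
    right; split=> /=; first by split; right; exists b.
    by split=> // -[/BBn[]]; exists b.
  suff /BBn[] : B (j b) by exists b.
  by exists (j b), (j (k (j b, j b))); right.
rewrite setUA -/F.
have FBB p z : F (p, z) -> (B `*` B) p.
  by case: p => x y Fp; have [_ ? _] := FA _ _ _ Fp; split=> //; exists y, z.
have FB p z : F (p, z) -> B z by case: p => x y /FA[].
split.
- move=> x y z [Fp|Gp].
    by have [Ax /domS dy /domS dz] := FA _ _ _ Fp; split=> //; [exact: dy|exact: dz].
  rewrite domG; have [[/= B2x B2y] _] := Gp; split=> //.
    by case: B2x => [/BA//|[w /jD[? _] <-]].
  by right; exact: GB Gp.
- rewrite domG => x y B2x B2y; have [[Bx By]|nB] := pselect ((B `*` B) (x, y)).
    by have [z Fz] := Fsq _ _ Bx By; exists z; left.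
  by exists (j (k (x, y))); right.
- move=> p z z' [Fp|[B2p [nBp /= ->]]] [Fp'|[B2p' [nBp' /= ->]]] //.
  + exact: Ffun Fp Fp'.
  + by have := FBB _ _ Fp.
  + by have := FBB _ _ Fp'.
- move=> p p' z [Fp|Gp] [Fp'|Gp'].
  + exact: Finj Fp Fp'.
  + by case: (BBn _ (FB _ _ Fp)); exact: GB Gp'.
  + by case: (BBn _ (FB _ _ Fp')); exact: GB Gp.
  + have [B2p [_ /= zE]] := Gp; have [B2p' [_ /= zE']] := Gp'.
    apply: kinj => //; apply: jinj; [exact: kB|exact: kB|by rewrite -zE].
Qed.

(** A list is determined by its length and the code of its entries obtained by
iterating an injection [B `*` B -> B]. *)
Lemma card_le_seq T U (A : set T) (B : set U) :
  infinite_set B -> A #<= B -> [set: seq A] #<= B.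
Proof.
move=> Binf /card_leP[f]; have BB := card_setX_le Binf.
have /infiniteP natB := Binf.
have [t0 Bt0] := infinite_setN0 Binf.
have [k [kB kinj]] := card_le_fun t0 BB.
apply: card_le_trans BB; apply: card_le_trans (card_le_setX natB (card_lexx B)).
pose fix enc (s : seq A) : U := if s is x :: s' then k (val (f x), enc s') else t0.
have encB s : B (enc s).
  by elim: s => //= x s IH; apply: kB; split=> //=; exact: set_valP.
apply: (@card_le_inj _ _ _ _ (fun s => (size s, enc s))) => [s _|s s' _ _ []].
  by split=> //; exact: encB.
elim: s s' => [|x s IH] [|x' s'] //= [ss'] kE.
suff [/val_inj fxx' /(IH _ ss')->] : (val (f x), enc s) = (val (f x'), enc s').
  by have -> : x = x' by apply: (@inj _ _ _ f) => //; rewrite in_setT.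
by apply: kinj kE; split=> //=; exact: set_valP.
Qed.

Lemma card_le_countable_fibers T U (A : set T) (C : set U) (f : T -> U) :
  (forall x, A x -> C (f x)) ->
  (forall y, C y -> countable [set x | A x /\ f x = y]) -> A #<= C `*` [set: nat].
Proof.
move=> fAC Cc; have /choice[g gP] y : exists g : T -> nat, C y ->
    forall x x', A x -> A x' -> f x = y -> f x' = y -> g x = g x' -> x = x'.
  have [Cy|nCy] := pselect (C y); last by exists (fun=> 0%N).
  have [g [_ ginj]] := card_le_fun 0%N (Cc _ Cy).
  by exists g => _ x x' Ax Ax' fx fx' gxx'; apply: ginj.
apply: (@card_le_inj _ _ _ _ (fun x => (f x, g (f x) x))) => [x Ax|x x' Ax Ax' [fE gE]].
  by split=> //; exact: fAC.
by apply: (gP (f x)) => //; [exact: fAC|rewrite gE fE].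
Qed.

Lemma infinite_absorbs_nat T (A : set T) : infinite_set A -> A `*` [set: nat] #<= A.
Proof.
move=> Ainf; apply: card_le_trans (card_setX_le Ainf).
by apply: card_le_setX => //; exact/infiniteP.
Qed.

Lemma not_card_le_powerset T (A : set T) : ~ ([set: set T] #<= A).
Proof.
have [->|/set0P[t At]] := eqVneq A set0.
  by move=> /card_le0P/seteqP[/(_ set0 I)].
move=> /(card_le_fun t)[f [_ finj]].
pose D := [set x | exists2 S, f S = x & ~ S x].
have [DfD|nDfD] := pselect (D (f D)); last by apply: (nDfD); exists D.
by case: (DfD) => S /finj -> //; apply.
Qed.

(** Well-order the power set of [A] and let [B] be the shortest initial segment that
does not inject into [A], or the whole power set.  An injection of [B] into a larger
set [C], built along the order, cannot get stuck: [C] would then be exhausted by a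
proper initial segment of [B] and so inject into [A]. *)
Lemma succ_card_exists T (A : set T) : exists B : set (set T), is_succ_card A B.
Proof.
have [r rwo] := well_ordering_principle (set T).
have rmin (P : set (set T)) : P !=set0 -> exists2 x, P x & forall y, P y -> r x y.
  move=> [x Px]; have [|z [[Pz zmin] _]] := rwo (mem P); first by exists x; exact/mem_set.
  by exists z => [|y Py]; [exact: set_mem|apply: zmin; exact/mem_set].
have rtot x y : r x y \/ r y x.
  have [|z [->|->] zmin] := rmin [set x; y]; first by exists x; left.
    by left; apply: zmin; right.
  by right; apply: zmin; left.
have ranti x y : r x y -> r y x -> x = y.
  move=> xy yx; have [|z [_ zuniq]] := rwo (mem [set x; y]).
    by exists x; apply: mem_set; left.
  have P1 : minimum_of r (mem [set x; y]) x.
    split=> [|t /set_mem[->//|->//]]; first by apply: mem_set; left.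
    by have [] := rtot x x.
  have P2 : minimum_of r (mem [set x; y]) y.
    split=> [|t /set_mem[->//|->//]]; first by apply: mem_set; right.
    by have [] := rtot y y.
  by rewrite -(zuniq _ P1) (zuniq _ P2).
have rtrans x y z : r x y -> r y z -> r x z.
  move=> xy yz; have [|w wP wmin] := rmin [set x; y; z]; first by exists x; left; left.
  have [wx wy wz] : [/\ r w x, r w y & r w z].
    by split; apply: wmin; [left; left|left; right|right].
  case: wP wx wy wz => [[->|->]|->] wx wy wz //; first by rewrite (ranti _ _ xy wx).
  by rewrite (ranti _ _ wy yz) in xy *.
pose seg w : set (set T) := [set v | r v w /\ v <> w].
have [B [BA Bdown Bseg]] : exists B : set (set T), [/\ ~ (B #<= A),
    forall v w, B w -> r v w -> B v & forall w, B w -> seg w #<= A].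
  have [big|small] := pselect (exists w, ~ (seg w #<= A)); last first.
    exists setT; split=> // [|w _]; first exact: not_card_le_powerset.
    by apply: contrapT => ?; apply: small; exists w.
  have [w wbig wmin] := rmin _ big.
  exists (seg w); split=> // [u v [vw vNw] uv|v [vw vNw]].
    split; first exact: rtrans vw.
    by move=> uw; apply: vNw; apply: ranti => //; rewrite -uw.
  by apply: contrapT => /wmin wv; apply: vNw; exact: ranti.
exists B; split; first by split=> //; have [] := card_le_total A B.
move=> V C [_ CA].
pose dom (F : set (set T * V)) : set (set T) := [set b | exists c, F (b, c)].
pose P (F : set (set T * V)) := [/\ F `<=` B `*` C,
  forall v w, dom F w -> r v w -> dom F v,
  forall b c c', F (b, c) -> F (b, c') -> c = c' &
  forall b b' c, F (b, c) -> F (b', c) -> b = b'].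
have [FF FFP FFtot|F [[FBC Fdown Ffun Finj] Fmax]] := @Zorn_bigcup _ P.
  have dir X Y : FF X -> FF Y -> exists Z, [/\ FF Z, X `<=` Z & Y `<=` Z].
    move=> FX FY; have [XY|YX] := FFtot _ _ FX FY; first by exists Y; split.
    by exists X; split.
  split.
  - by move=> z [X /FFP[+ _ _ _]]; exact.
  - move=> v w [c [X FX Xwc]] vw; have [_ + _ _] := FFP _ FX.
    by move=> /(_ v w)[|//|d Xvd]; [exists c|exists d; exists X].
  - move=> b c c' [X FX Xb] [Y FY Yb]; have [Z [FZ XZ YZ]] := dir _ _ FX FY.
    by have [_ _ + _] := FFP _ FZ => /(_ b c c'); apply; [exact: XZ|exact: YZ].
  - move=> b b' c [X FX Xb] [Y FY Yb]; have [Z [FZ XZ YZ]] := dir _ _ FX FY.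
    by have [_ _ _] := FFP _ FZ => /(_ b b' c); apply; [exact: XZ|exact: YZ].
have [allB|notB] := pselect (B `<=` dom F).
  apply/card_le_relP; exists (fun b c => F (b, c)); split=> // b /allB[c Fbc].
  by exists c => //; have [] := FBC _ Fbc.
have [b [Bb nb] bmin] : exists2 b, (B `\` dom F) b & forall v, (B `\` dom F) v -> r b v.
  apply: rmin; apply: contrapT => h; apply: notB => v Bv.
  by apply: contrapT => nv; apply: h; exists v.
have domseg : dom F `<=` seg b.
  move=> d dd; have bd : ~ r b d by move=> /(Fdown _ _ dd).
  by split=> [|db]; [have [] := rtot b d|rewrite db in dd].
exfalso.
have [allC|notC] := pselect (forall c, C c -> exists b, F (b, c)).
  apply: CA; apply: card_le_trans (Bseg _ Bb); apply: card_le_trans (subset_card_le domseg).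
  apply/card_le_relP; exists (fun c b => F (b, c)); split=> [c /allC[d Fdc]|c c' d].
    by exists d => //; exists c.
  exact: Ffun.
have [c [Cc nc]] : exists c, C c /\ forall b, ~ F (b, c).
  apply: contrapT => h; apply: notC => c Cc; apply: contrapT => nc; apply: h.
  by exists c; split=> // d Fdc; apply: nc; exists d.
apply: (Fmax (F `|` [set (b, c)])).
  split; first exact: subsetUl.
  by move=> sub; apply: (nc b); apply: sub; right.
split=> [z [/FBC//|->//]|v w [d [Fwd|[-> _]]] vw|
  v d d' [Fd|[ea eb]] [Fd'|[ea' eb']]|v v' d [Fd|[ea eb]] [Fd'|[ea' eb']]].
- by have [|e Fve] := Fdown _ _ _ vw; [exists d|exists e; left].
- have [->|vb] := pselect (v = b); first by exists c; right.
  have [[e Fve]|nv] := pselect (dom F v); first by exists e; left.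
  by case: vb; apply: ranti => //; apply: bmin; split=> //; exact: Bdown vw.
- exact: Ffun Fd Fd'.
- by subst; case: nb; exists d.
- by subst; case: nb; exists d'.
- by subst.
- exact: Finj Fd Fd'.
- by subst; case: (nc v).
- by subst; case: (nc v').
- by subst.
Qed.

(** * Super-sequences and local bases *)

(** The finite intersection property.  Finite subfamilies are lists, so that the
index type may be arbitrary. *)
Lemma compact_closed_family (X : topologicalType) I (C : I -> set X) (K U : set X) :
  compact K -> (forall i, closed (C i)) -> open U ->
  K `&` \bigcap_i C i `<=` U ->
  exists s : seq I, K `&` foldr (fun i A => C i `&` A) setT s `<=` U.
Proof.
move=> cK cC oU KCU; apply: contrapT => noS.
pose cap s := foldr (fun i A => C i `&` A) setT s.
pose D s := (K `&` cap s) `\` U.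
have capD s t : cap (s ++ t) = cap s `&` cap t.
  by elim: s => [|i s /= ->]; rewrite ?setTI ?setIA.
have FP : ProperFilter (filter_from setT D).
  apply: filter_from_proper; last first.
    move=> s _; apply: contrapT => /set0P/negP/negPn/eqP D0.
    by apply: noS; exists s => x Kx; apply: contrapT => nU; suff : set0 x by []; rewrite -D0.
  apply: filter_from_filter; first by exists [::].
  by move=> s t _ _; exists (s ++ t) => // x; rewrite /D capD => -[[? []]].
have [|p [Kp clp]] := cK _ FP; first by exists [::] => // x [[]].
have Up : U p.
  apply: KCU; split=> // i _; apply: cC => B pB; apply: clp => //.
  by exists [:: i] => // x [[_ []]].
have [||q [[_ nUq] Uq]] := clp (D [::]) U; [by exists [::]| |exact: nUq].
exact: open_nbhs_nbhs.
Qed.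

Lemma hausdorff_set_type (X : topologicalType) (A : set X) :
  hausdorff_space X -> hausdorff_space A.
Proof.
move=> hX p q pq; apply/val_inj/hX => B C pB qC.
have vc : continuous (val : A -> X) by exact: (@initial_continuous A X val).
have [r [Br Cr]] := pq _ _ (vc _ _ pB) (vc _ _ qC).
by exists (val r).
Qed.

Section super_sequences.
Context {X : topologicalType}.
Implicit Types (S : set X) (x : X).

(** A point of [S] other than [x] has a neighbourhood disjoint from one of [x]; that
neighbourhood meets [S] in a finite set, so the point is isolated in [S]. *)
Lemma super_sequence_toI S x : hausdorff_space X -> S x -> infinite_set S ->
  (forall U, nbhs x U -> finite_set (S `\` U)) -> super_sequence_to S x.
Proof.
move=> hX Sx Sinf Sfin; pose y : S := SigSub (mem_set Sx); exists y => //.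
have hS : hausdorff_space S by exact: hausdorff_set_type.
have cof (V : set S) : nbhs y V -> finite_set (~` V).
  rewrite nbhsE => -[W [[W' oW' <-] W'y] WV].
  apply: (@sub_finite_set _ _ (val @^-1` (S `\` W'))).
    by move=> z nVz; split; [exact: set_valP|move=> ?; exact/nVz/WV].
  apply: finite_preimage; first by move=> ? ? _ _; exact: val_inj.
  by apply: Sfin; exact: open_nbhs_nbhs.
have TS : infinite_set [set: S].
  move=> /(finite_image val) fS; apply: Sinf; apply: sub_finite_set fS.
  by move=> z Sz; exists (SigSub (mem_set Sz)).
split=> //; apply/seteqP; split=> [z|_ ->].
  apply: contra_notP => /eqP zy; split; first exact: in_setT.
  have := hS; rewrite open_hausdorff => /(_ _ _ zy)[[A B]/= [Az By] [oA oB /eqP AB]].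
  have Afin : finite_set (A `\ z).
    apply/finite_setD/(@sub_finite_set _ _ (~` B)); first exact/disjoints_subset.
    by apply: cof; apply: open_nbhs_nbhs; split=> //; exact: set_mem.
  exists (A `&` ~` (A `\ z)).
    apply: open_nbhs_nbhs; split; last by split; [exact: set_mem|case=> _; exact].
    apply: openI => //; apply: closed_openC.
    by have /accessible_finite_set_closed := hausdorff_accessible hS; exact.
  apply/seteqP; split=> [t [[At nt] _]|_ ->].
    by apply: contrapT => tz; apply: nt.
  by split=> //; split; [exact: set_mem|case=> _; exact].
move=> [_ [V Vy]]; rewrite setIT => V1; apply: TS.
rewrite -(setvU V) finite_setU; split; first exact: cof.
by rewrite V1.
Qed.

Lemma super_sequence_sub S x : super_sequence_to S x ->
  [/\ S x, infinite_set S & forall U, nbhs x U -> finite_set (S `\` U)].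
Proof.
move=> [y [Sinf _ _ Sfin] <-]; split; first exact: set_valP.
  move=> fS; apply: Sinf; apply: (@sub_finite_set _ _ (val @^-1` S)).
    by move=> z _; exact: set_valP.
  by apply: finite_preimage => // ? ? _ _; exact: val_inj.
move=> U yU; have /Sfin : nbhs y (val @^-1` U) by exact: (@initial_continuous S X val).
move=> /(finite_image val); apply: sub_finite_set => s [Ss nUs].
by exists (SigSub (mem_set Ss)).
Qed.

Lemma super_sequence_separated S x s : super_sequence_to S x -> S s -> s <> x ->
  exists2 U, nbhs x U & ~ U s.
Proof.
move=> [y [_ hS _ _] <-] Ss sy; pose z : S := SigSub (mem_set Ss).
have zy : z != y by apply/eqP => zy; apply: sy; rewrite -zy.
move: hS; rewrite open_hausdorff => /(_ _ _ zy)[[A B]/= [Az By] [oA oB /eqP AB]].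
case: oB By AB => W oW <- /set_mem By AB; exists W.
  by apply: open_nbhs_nbhs; split.
move=> Ws; have : (A `&` val @^-1` W) z by split=> //; exact: set_mem.
by rewrite AB.
Qed.

(** Send a point of [S] other than [x] to a basic neighbourhood that misses it: the
fibres are finite. *)
Lemma super_sequence_card_le S x (B : set (set X)) T (C : set T) :
  super_sequence_to S x -> local_basis x B -> infinite_set C -> B #<= C ->
  S #<= C.
Proof.
move=> Sx [Bx xB] Cinf BC; have CC := card_setX_le Cinf.
have [_ _ Sfin] := super_sequence_sub Sx.
have xS : [set x] #<= C.
  have [c Cc] := infinite_setN0 Cinf.
  by apply: (@card_le_inj _ _ _ _ (fun=> c)) => // ? ? -> ->.
have S1 : S `\ x #<= C.
  have /choice[f fP] s : exists b, (S `\ x) s -> B b /\ ~ b s.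
    have [[Ss sx]|nSs] := pselect ((S `\ x) s); last by exists set0.
    have [U /xB[b Bb bU] nUs] := super_sequence_separated Sx Ss sx.
    by exists b => _; split=> // /bU.
  apply: card_le_trans (infinite_absorbs_nat Cinf).
  apply: card_le_trans (card_le_setX BC (card_lexx _)).
  apply: (card_le_countable_fibers (f := f)) => [s /fP[]//|b Bb].
  apply/finite_set_countable/(@sub_finite_set _ _ (S `\` b)).
    by move=> s [/[dup] -[Ss _] /fP[_ nfs] <-].
  by apply: Sfin; apply: open_nbhs_nbhs; exact: Bx.
apply: card_le_trans (card_le_setU Cinf CC S1 xS).
apply: subset_card_le => s Ss; have [->|/eqP] := eqVneq s x; first by right.
by left.
Qed.

(** A value [s <> x] is taken only finitely often, since some neighbourhood of [x]
avoids it; hence the range is as large as the index set. *)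
Lemma null_family_super_sequence I (J : set I) (g : I -> X) x :
  hausdorff_space X -> infinite_set J ->
  (forall i, J i -> g i <> x) ->
  (forall U, nbhs x U -> finite_set (J `&` g @^-1` (~` U))) ->
  let S := x |` g @` J in
  [/\ infinite_set S, super_sequence_to S x & J #<= S].
Proof.
move=> hX Jinf gx gfin S.
have fib s : S s -> finite_set [set i | J i /\ g i = s].
  move=> Ss; have [->|sx] := eqVneq s x.
    by apply: (@sub_finite_set _ _ set0) => // i [/gx].
  have := hX; rewrite open_hausdorff => /(_ _ _ sx)[[A B]/= [As Bx] [_ oB /eqP AB]].
  apply: sub_finite_set (gfin B _); last first.
    by apply: open_nbhs_nbhs; split=> //; exact: set_mem.
  move=> i [Ji gis]; split=> //=; rewrite gis => Bs; suff : set0 s by [].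
  by rewrite -AB; split=> //; exact: set_mem.
have Sinf : infinite_set S.
  move=> Sf; apply: Jinf; apply: (@sub_finite_set _ _ (\bigcup_(s in S) [set i | J i /\ g i = s])).
    by move=> i Ji; exists (g i) => //; right; exists i.
  exact: bigcup_finite.
split=> //.
  apply: super_sequence_toI => //; first by left.
  move=> U xU; apply: sub_finite_set (finite_image g (gfin U xU)).
  move=> s [[->|[i Ji <-]] nU]; last by exists i.
  by case: nU; exact: nbhs_singleton.
apply: card_le_trans (infinite_absorbs_nat Sinf).
apply: (card_le_countable_fibers (f := g)) => [i Ji|s Ss]; first by right; exists i.
exact/finite_set_countable/fib.
Qed.

(** In a locally compact space a point has a local basis as small as any family of
neighbourhoods shrinking to it: by compactness, the finite intersections are one. *)
Lemma local_basis_of_closed_nbhs (p : X) (CC : set (set X)) K T (S : set T) :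
  infinite_set S -> CC #<= S -> (forall C, CC C -> closed C /\ nbhs p C) ->
  compact K -> CC K -> \bigcap_(C in CC) C `<=` [set p] ->
  exists2 B, local_basis p B & B #<= S.
Proof.
move=> Sinf CS Ccl cK CK Cp.
pose cap (s : seq CC) := foldr (fun (i : CC) A => val i `&` A) setT s.
have capn s : nbhs p (cap s).
  elim: s => [|C s IH] /=; first exact: filterT.
  by apply: filterI => //; have [] := Ccl _ (set_valP C).
exists [set interior (K `&` cap s) | s in [set: seq CC]]; last first.
  by apply: card_le_trans (card_image_le _ _) _; exact: card_le_seq.
split=> [_ [s _ <-]|U].
  split; first exact: open_interior.
  by apply: (@filterI _ (nbhs p)) => //; have [] := Ccl _ CK.
rewrite nbhsE => -[V [oV Vp] VU].
have [i|x [Kx cx]|s sV] := @compact_closed_family X CC val K V cK _ oV.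
- by have [] := Ccl _ (set_valP i).
- have -> // : x = p; apply: Cp => C CC'.
  exact: (cx (SigSub (mem_set CC')) I).
exists (interior (K `&` cap s)); first by exists s.
by apply: subset_trans VU; apply: subset_trans sV; exact: interior_subset.
Qed.

Lemma is_character_super_sequence T (A : set T) :
  infinite_set A -> (forall x : X, exists2 B, local_basis x B & B #<= A) ->
  (exists S x, super_sequence_to S x /\ A #<= S) -> is_character X A.
Proof.
move=> Ainf basA [S [x [Sx AS]]]; split=> // U B Binf /(_ x)[C xC CB].
exact: card_le_trans AS (super_sequence_card_le Sx xC Binf CB).
Qed.

(** Super-sequences have size at most [|A|] and one reaches it, so the least
infinite cardinal that none of them reaches is the successor of [|A|]. *)
Lemma is_super_sequence_card_succ T U (A : set T) (B : set U) :
  infinite_set A -> (forall x : X, exists2 B, local_basis x B & B #<= A) ->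
  (exists S x, super_sequence_to S x /\ A #<= S) ->
  is_succ_card A B -> is_super_sequence_card X B.
Proof.
move=> Ainf basA [S [x [Sx AS]]] [[AB BA] Bmin]; split.
- by move=> /(card_le_finite AB).
- move=> [S' [y [S'y BS']]]; apply: BA; apply: card_le_trans BS' _.
  by have [C yC CA] := basA y; exact: super_sequence_card_le S'y yC Ainf CA.
- move=> V C Cinf noC; apply: Bmin.
  have nCA : ~ (C #<= A).
    by move=> CA; apply: noC; exists S, x; split=> //; exact: card_le_trans AS.
  by split=> //; have [|/nCA] := card_le_total A C.
Qed.

End super_sequences.

Lemma shift_continuous (K : topologicalZmodType) (a : K) :
  continuous (fun y : K => y + a).
Proof.
move=> x; apply: (@continuous_comp _ _ _ (fun y => (y, a)) (fun p : K * K => p.1 + p.2)).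
  by apply: cvg_pair; [exact: cvg_id|exact: cvg_cst].
exact: add_continuous.
Qed.

Lemma local_basis_translate (K : topologicalZmodType) (B : set (set K)) (x : K) :
  local_basis (0 : K) B ->
  local_basis x [set (fun y => y - x) @^-1` b | b in B].
Proof.
move=> [Bo B0]; split=> [_ [b Bb <-]|U xU].
  have [ob b0] := Bo _ Bb; split=> /=; last by rewrite subrr.
  by apply: open_comp => // y _; exact: shift_continuous.
have /B0[b Bb bU] : nbhs (0 : K) ((fun y => y + x) @^-1` U).
  by apply: shift_continuous; rewrite add0r.
exists ((fun y => y - x) @^-1` b); first by exists b.
by move=> y /bU /=; rewrite subrK.
Qed.

Lemma local_basis_subspace (X : topologicalType) (G : set X) (x : G) B :
  local_basis (val x) B -> local_basis x [set (val : G -> X) @^-1` b | b in B].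
Proof.
move=> [Bo xB]; split=> [_ [b /Bo[ob bx] <-]|U].
  by split=> //; exists b.
rewrite nbhsE => -[W [[W' oW' <-] W'x] WU].
have /xB[b Bb bW] : nbhs (val x) W' by exact: open_nbhs_nbhs.
exists ((val : G -> X) @^-1` b); first by exists b.
by apply: subset_trans WU => y /bW.
Qed.

(** * The circle group *)

Section circle.
Context {R : rcfType}.

Definition normsq (z : R[i]) : R := Re z ^+ 2 + Im z ^+ 2.

Lemma normsq_ge0 z : 0 <= normsq z.
Proof. by rewrite addr_ge0 // sqr_ge0. Qed.

Lemma normsqM (z w : R[i]) : normsq (z * w) = normsq z * normsq w.
Proof. by case: z w => [a b] [c d]; rewrite /normsq /=; ring. Qed.

Lemma normsqN (z : R[i]) : normsq (- z) = normsq z.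
Proof. by case: z => [a b]; rewrite /normsq /= !sqrrN. Qed.

Lemma normsq1 : normsq 1 = 1.
Proof. by rewrite /normsq /=; ring. Qed.

Lemma normsq_parallelogram (z w : R[i]) :
  normsq (z + w) + normsq (z - w) = 2 * normsq z + 2 * normsq w.
Proof. by case: z w => [a b] [c d]; rewrite /normsq /=; ring. Qed.

Lemma normsq_add_le (z w : R[i]) : normsq (z + w) <= 2 * normsq z + 2 * normsq w.
Proof. by rewrite -normsq_parallelogram lerDl normsq_ge0. Qed.

Lemma normsqX (z : R[i]) n : normsq (z ^+ n) = normsq z ^+ n.
Proof. by elim: n => [|n IH]; rewrite ?normsq1 // !exprS normsqM IH. Qed.

(** The group law is written additively, so that maps into the circle inherit the
pointwise structure of an abelian group and characters are additive maps. *)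
Definition circle := {z : R[i] | normsq z == 1}.
HB.instance Definition _ := SubChoice.on circle.

Implicit Types s t : circle.

Definition cval s : R[i] := val s.

Lemma cval_inj : injective cval. Proof. exact: val_inj. Qed.

Lemma normsq_circle s : normsq (cval s) = 1.
Proof. exact/eqP/(valP s). Qed.

Definition circle_mul s t : circle :=
  exist _ (cval s * cval t) (introT eqP (etrans (normsqM _ _)
    (etrans (congr2 *%R (normsq_circle s) (normsq_circle t)) (mulr1 1)))).

Fact circle_conj_subproof s : normsq (conjc (cval s)) == 1.
Proof. by have := normsq_circle s; case: (cval s) => a b; rewrite /normsq /= sqrrN => ->. Qed.

Definition circle_conj s : circle := exist _ (conjc (cval s)) (circle_conj_subproof s).

Definition circle_one : circle := exist _ 1 (introT eqP normsq1).

Fact circle_mulA : associative circle_mul.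
Proof. by move=> s t u; apply/cval_inj; exact: mulrA. Qed.
Fact circle_mulC : commutative circle_mul.
Proof. by move=> s t; apply/cval_inj; exact: mulrC. Qed.
Fact circle_mul1 : left_id circle_one circle_mul.
Proof. by move=> s; apply/cval_inj; exact: mul1r. Qed.
Fact circle_mulV : left_inverse circle_one circle_conj circle_mul.
Proof.
move=> [[a b] /= ab]; apply/val_inj => /=; have := eqP ab; rewrite /normsq /= => e.
by apply/eqP; rewrite eq_complex /=; apply/andP; split; apply/eqP; [rewrite -e|]; ring.
Qed.

HB.instance Definition _ :=
  GRing.isZmodule.Build circle circle_mulA circle_mulC circle_mul1 circle_mulV.

Lemma cval0 : cval (0 : circle) = 1. Proof. by []. Qed.

Lemma cvalD s t : cval (s + t) = cval s * cval t. Proof. by []. Qed.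

Lemma cvalMn s n : cval (s *+ n) = cval s ^+ n.
Proof. by elim: n => [|n IH]; rewrite ?mulr0n // mulrS exprS cvalD IH. Qed.

Lemma normsq_rotate s z : normsq (cval s * z) = normsq z.
Proof. by rewrite normsqM normsq_circle mul1r. Qed.

(** The distance to [0] in the circle is measured by [1 - re s], half the square of
the Euclidean distance from [s] to [1]. *)
Definition re s : R := Re (cval s).

Lemma re0 : re 0 = 1. Proof. by []. Qed.

Lemma reN s : re (- s) = re s.
Proof. by case: s => -[]. Qed.

Lemma reDB s t : re (s + t) + re (s - t) = 2 * re s * re t.
Proof. by case: s t => [[a b] ?] [[c d] ?]; rewrite /re /=; ring. Qed.

Lemma re_le1 s : re s <= 1.
Proof.
have := normsq_circle s; rewrite /re /normsq; case: (cval s) => a b /=; nra.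
Qed.

Lemma normsq_circle_sub s t : normsq (cval s - cval t) = 2 * (1 - re (s - t)).
Proof.
have := normsq_circle s; have := normsq_circle t.
by case: s t => [[a b] ?] [[c d] ?]; rewrite /re /normsq /=; nra.
Qed.

Lemma re_eq1 s : re s = 1 -> s = 0.
Proof.
move=> s1; apply/cval_inj; have := normsq_circle s; move: s1; rewrite /re /normsq.
case: (cval s) => a b /= -> e; congr Complex; apply/eqP; rewrite -sqrf_eq0; apply/eqP.
by move: e; lra.
Qed.

Lemma re_dist_triangle s t : 1 - re (s + t) <= 2 * (1 - re s) + 2 * (1 - re t).
Proof.
have e u : 2 * (1 - re u) = normsq (cval u - 1) by rewrite -cval0 normsq_circle_sub subr0.
have : normsq (cval s * (cval t - 1) + (cval s - 1)) <=
    2 * normsq (cval t - 1) + 2 * normsq (cval s - 1).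
  by apply: le_trans (normsq_add_le _ _) _; rewrite normsq_rotate.
rewrite (_ : cval s * (cval t - 1) + (cval s - 1) = cval (s + t) - 1); last by rewrite cvalD; ring.
by rewrite -!e; lra.
Qed.

Lemma circle_divisible s n : (0 < n)%N -> exists t, t *+ n = s.
Proof.
move=> n0; pose w := n.-root (cval s).
have wn : w ^+ n = cval s by exact: rootCK.
have w1 : normsq w == 1.
  by rewrite -(eqrXn2 n0) ?normsq_ge0 // expr1n -normsqX wn normsq_circle.
by exists (exist _ w w1); apply/cval_inj; rewrite cvalMn.
Qed.

Lemma circle_minus1 : exists s : circle, s *+ 2 = 0 /\ cval s = -1.
Proof.
have e : normsq (-1) == 1 :> R by apply/eqP; rewrite /normsq /=; ring.
exists (exist (fun z : R[i] => normsq z == 1) _ e); split=> //.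
by apply/cval_inj; rewrite cvalMn {1}/cval /= sqrrN expr1n.
Qed.

(** A root of [1 + X + ... + X^(p - 1)] is a [p]-th root of unity, and it is not [1]
because [p] is nonzero in the field. *)
Lemma circle_torsion p : prime p -> exists2 t : circle, t <> 0 & t *+ p = 0.
Proof.
move=> pp; have p1 := prime_gt1 pp.
have [|w] := @closed_rootP _ (\poly_(i < p) (1 : R[i])) _.
  by rewrite size_poly_eq ?oner_neq0 // -(subnKC p1).
rewrite /root horner_poly => /eqP w0.
have wp : w ^+ p = 1.
  apply/eqP; rewrite -subr_eq0 subrX1 -[X in _ * X](_ : \sum_(i < p) 1 * w ^+ i = _).
    by rewrite w0 mulr0.
  by apply: eq_bigr => i _; rewrite mul1r.
have w1 : normsq w == 1.
  by rewrite -(eqrXn2 (prime_gt0 pp)) ?normsq_ge0 // expr1n -normsqX wp normsq1.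
exists (exist _ w w1); last by apply/cval_inj; rewrite cvalMn.
move=> /(congr1 cval); rewrite {1}/cval /= cval0 => we; move: w0; rewrite we.
under eq_bigr do rewrite expr1n mulr1.
by rewrite sumr_const card_ord => /eqP; rewrite pnatr_eq0 => /eqP p0; rewrite p0 in p1.
Qed.

Fact circle_345_subproof : normsq (Complex (3 / 5) (4 / 5)) == 1.
Proof. by apply/eqP; rewrite /normsq /=; field. Qed.

Definition circle_345 : circle := exist _ (Complex (3 / 5) (4 / 5)) circle_345_subproof.

(** Every positive power of [3 + 4i] is congruent to [3 + 4i] modulo [5], hence not
real. *)
Lemma circle_345_infinite_order n : (0 < n)%N -> circle_345 *+ n <> 0.
Proof.
case: n => // n _.
have [a [b ab]] : exists a b : int,
    (Complex 3 4 : R[i]) ^+ n.+1 = Complex (5 * a + 3)%:~R (5 * b + 4)%:~R.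
  elim: n => [|n [a [b IH]]]; first by exists 0, 0; rewrite expr1 !mulr0 !add0r.
  exists (3 * a - 4 * b - 2), (4 * a + 3 * b + 4); rewrite exprS IH.
  by apply/eqP; rewrite eq_complex /=; apply/andP; split; apply/eqP; ring.
move=> /(congr1 cval); rewrite cvalMn cval0 /cval /= => /(congr1 ( *%R (Complex 5 0 ^+ n.+1))).
rewrite -exprMn mulr1.
have -> : Complex 5 0 * Complex (3 / 5) (4 / 5) = Complex 3 4 :> R[i].
  by apply/eqP; rewrite eq_complex /=; apply/andP; split; apply/eqP; field.
rewrite ab.
have -> : Complex (5 : R) 0 ^+ n.+1 = Complex (5 ^+ n.+1) 0.
  elim: {ab} n => // n IH; rewrite exprS IH [in RHS]exprS; set e := 5 ^+ n.+1.
  by apply/eqP; rewrite eq_complex /=; apply/andP; split; apply/eqP; ring.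
move=> [_ /eqP]; rewrite intr_eq0 => /eqP; lia.
Qed.

(** The divisible hull of [circle_345] in the circle.  It contains a copy of every
cyclic group, while its countability lets the number of nonzero coordinates control
the size of a group embedded with values in it. *)
Definition circle_hull : set circle :=
  [set s | exists n (k : int), s *+ n.+1 = circle_345 *~ k].

Lemma circle_hull_sub s t : circle_hull s -> circle_hull t -> circle_hull (s - t).
Proof.
move=> [n [k nk]] [m [l ml]]; exists (n.+1 * m.+1).-1%N, (k * m.+1%:Z - l * n.+1%:Z).
rewrite prednK ?muln_gt0 // mulrnBl mulrnA nk [in X in _ - X]mulnC mulrnA ml.
by rewrite mulrzBr !mulrzA -!pmulrn.
Qed.

Lemma circle_hull0 : circle_hull 0.
Proof. by exists 0%N, 0; rewrite mulr0z mul0rn. Qed.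

Lemma circle_hull_root n s : (0 < n)%N -> circle_hull s ->
  exists2 t, circle_hull t & t *+ n = s.
Proof.
move=> n0 [m [k mk]]; have [t ts] := circle_divisible s n0; exists t => //.
exists (n * m.+1).-1%N, k.
by rewrite prednK ?muln_gt0 ?n0 // mulrnA ts.
Qed.

Lemma circle_hull_torsion p : prime p ->
  exists2 t : circle, circle_hull t & t <> 0 /\ t *+ p = 0.
Proof.
move=> pp; have [t t0 tp] := circle_torsion pp; exists t => //.
by exists p.-1, 0; rewrite prednK ?prime_gt0 // tp mulr0z.
Qed.

Lemma circle_hull_345 : circle_hull circle_345.
Proof. by exists 0%N, 1. Qed.

Lemma countable_circle_hull : countable circle_hull.
Proof.
have -> : circle_hull = \bigcup_(p : nat * int) [set s | s *+ p.1.+1 = circle_345 *~ p.2].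
  by apply/seteqP; split=> [s [n [k nk]]|s [[n k] _ nk]]; [exists (n, k)|exists n, k].
apply: bigcup_countable => // -[n k] _ /=; apply: finite_set_countable.
set c := circle_345 *~ k.
have [r rE] := closed_field_poly_normal ('X^(n.+1) - (cval c)%:P : {poly R[i]}).
apply: (@sub_finite_set _ _ (cval @^-1` [set` r])).
  move=> s /= sc.
  have : root ('X^(n.+1) - (cval c)%:P) (cval s).
    by rewrite /root !hornerE -cvalMn sc subrr.
  rewrite rE rootZ ?root_prod_XsubC //.
  by rewrite lead_coefXnsubC // oner_eq0.
apply: finite_preimage => [? ? _ _|]; first exact: cval_inj.
exact: finite_seq.
Qed.

End circle.

(** * Embedding an abelian group into finitely supported maps *)

Section subgroups.
Context {Z : zmodType} (X : set Z) (subX : subgroup X).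

Lemma subgroup0 : X 0.
Proof. by have [/set_mem] := subX. Qed.

Lemma subgroupB x y : X x -> X y -> X (x - y).
Proof. by have [_ XB] := subX => /mem_set Xx /mem_set Xy; exact/set_mem/XB. Qed.

Lemma subgroupN x : X x -> X (- x).
Proof. by move=> Xx; rewrite -[- x]add0r; exact: subgroupB subgroup0 Xx. Qed.

Lemma subgroupD x y : X x -> X y -> X (x + y).
Proof. by move=> Xx Xy; rewrite -[y]opprK; apply: subgroupB => //; exact: subgroupN. Qed.

Lemma subgroupMn x n : X x -> X (x *+ n).
Proof.
by move=> Xx; elim: n => [|n IH]; rewrite ?mulr0n ?mulrS; [exact: subgroup0|exact: subgroupD].
Qed.

Lemma subgroupMz x k : X x -> X (x *~ k).
Proof.
move=> Xx; case: (intP k) => [|n|n]; rewrite ?mulr0z ?mulrNz -?pmulrn.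
- exact: subgroup0.
- exact: subgroupMn.
- exact/subgroupN/subgroupMn.
Qed.

Lemma subgroup_Bezout x (p : nat) (k : int) : prime p -> ~~ (p %| `|k|)%N ->
  X (x *+ p) -> X (x *~ k) -> X x.
Proof.
move=> pp pk Xp Xk.
have : coprimez p k by rewrite coprimezE /= prime_coprime.
move=> /coprimezP[[u v] /= uv].
rewrite -[x]mulr1z -uv mulrzDr mulrC [v * k]mulrC !mulrzA -pmulrn.
by apply: subgroupD; exact: subgroupMz.
Qed.

End subgroups.

Lemma subgroupI (Z : zmodType) (X : set Z) :
  X 0 -> (forall x y, X x -> X y -> X (x - y)) -> subgroup X.
Proof. by move=> X0 XB; split=> [|x y /set_mem Xx /set_mem Xy]; apply/mem_set => //; exact: XB. Qed.

Section embedding.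
Context {Z T : zmodType} (X : set Z) (D : set T).
Hypotheses (subX : subgroup X) (subD : subgroup D).
Hypothesis D_root : forall (n : nat) d, (0 < n)%N -> D d -> exists2 e, D e & e *+ n = d.
Hypothesis D_torsion : forall p : nat, prime p -> exists2 d, D d & d <> 0 /\ d *+ p = 0.
Hypothesis D_free : exists2 d, D d & forall n, (0 < n)%N -> d *+ n <> 0.

Let W := (Z * (Z -> T))%type.
Implicit Types (A : set W) (p q : W).

Let dom A : set Z := [set x | exists g, A (x, g)].

(* The coordinates in use are indexed by elements of the domain, so that an element
outside the domain is a coordinate at which all images vanish. *)
Let good A := [/\ forall p, A p -> [/\ X p.1, forall i, D (p.2 i),
    finite_set [set i | p.2 i <> 0] & forall i, p.2 i <> 0 -> dom A i],
  forall p q, A p -> A q -> A (p - q) &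
  forall p, A p -> p.1 = 0 <-> p.2 = 0].

Let mulz_fst (w : W) (k : int) : (w *~ k).1 = w.1 *~ k.
Proof.
case: (intP k) => [|n|n]; rewrite ?mulr0z ?mulrNz -?pmulrn //=; last congr (- _);
  by elim: n => [|n IH]; rewrite ?mulr1n // mulrS [in RHS]mulrS /= IH.
Qed.

Let mulz_fct (g : Z -> T) (k : int) i : (g *~ k) i = g i *~ k.
Proof.
case: (intP k) => [|n|n]; rewrite ?mulr0z ?mulrNz -?pmulrn //=; last congr (- _);
  by elim: n => [|n IH]; rewrite ?mulr1n // mulrS [in RHS]mulrS -IH.
Qed.

Let mulz_snd (w : W) (k : int) i : (w *~ k).2 i = w.2 i *~ k.
Proof.
rewrite -mulz_fct; congr (_ i).
case: (intP k) => [|n|n]; rewrite ?mulr0z ?mulrNz -?pmulrn //=; last congr (- _);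
  by elim: n => [|n IH]; rewrite ?mulr1n // mulrS [in RHS]mulrS /= IH.
Qed.

Let good_extend A x (g : Z -> T) : good A -> A 0 -> X x -> (forall i, D (g i)) ->
  finite_set [set i | g i <> 0] -> (forall i, g i <> 0 -> dom A i \/ i = x) ->
  (forall p (k : int), A p -> p.1 + x *~ k = 0 <-> forall i, p.2 i + g i *~ k = 0) ->
  good [set r | exists p (k : int), A p /\ r = p + (x, g) *~ k].
Proof.
move=> [Apt AB A0] AA0 Xx Dg fing gdom inj; set A' := [set r | _].
have AA' : A `<=` A' by move=> p Ap; exists p, 0; rewrite mulr0z addr0.
have domA' : dom A `<=` dom A' by move=> i [h /AA' Ah]; exists h.
have A'x : A' (x, g) by exists 0, 1; rewrite mulr1z add0r.
split=> [_ [p [k [Ap ->]]]|_ _ [p [k [Ap ->]]] [q [l [Aq ->]]]|_ [p [k [Ap ->]]]].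
- have [Xp Dp finp pdom] := Apt _ Ap; split.
  + by rewrite /= mulz_fst; apply: subgroupD => //; exact: subgroupMz.
  + move=> i; rewrite /= -[(p.2 + _) i]/(p.2 i + _) mulz_snd.
    by apply: subgroupD => //; exact: subgroupMz.
  + apply: (@sub_finite_set _ _ ([set i | p.2 i <> 0] `|` [set i | g i <> 0])).
      move=> i /=; rewrite -[(p.2 + _) i]/(p.2 i + _) mulz_snd => n0.
      have [p0|] := eqVneq (p.2 i) 0; last by move=> /eqP; left.
      by right=> /= g0; apply: n0; rewrite /= p0 g0 mul0rz addr0.
    by rewrite finite_setU.
  + move=> i /=; rewrite -[(p.2 + _) i]/(p.2 i + _) mulz_snd => n0.
    have [p0|/eqP/pdom/domA'//] := eqVneq (p.2 i) 0.
    have [|/domA'//|->] := gdom i; last by exists g.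
    by move=> g0; apply: n0; rewrite /= p0 g0 mul0rz addr0.
- exists (p - q), (k - l); split; first exact: AB.
  by rewrite mulrzBr opprD addrACA.
- rewrite /= mulz_fst inj //; split=> [h|/(congr1 (fun f => f _)) h i].
    by apply/funext => i; rewrite -[LHS]/(p.2 i + _) mulz_snd h.
  by have := h i; rewrite -[LHS]/(p.2 i + _) mulz_snd.
Qed.

(** Any abelian group embeds into a direct sum of copies of a divisible group [D]
that contains all cyclic groups.  Consider a maximal graph [A] of a partial
embedding, and suppose that [x] is outside its domain.  If no positive multiple of
[x] is in the domain, extend by sending [x] to an element of infinite order placed
at the coordinate [x].  Otherwise, replacing [x] by a multiple, [x *+ l] is in the
domain for a prime [l].  If some [t] outside the domain satisfies [t *+ l = 0],
extend by sending [t] to an element of order [l] at the coordinate [t].  If there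
is no such [t], any [l]-th root of the image of [x *+ l] is a possible image of
[x]: a failure of injectivity would give [y] in the domain with the same image as
[x], and [t = x - y]. *)
Lemma finite_support_embedding : exists f : Z -> Z -> T,
  [/\ forall x y, X x -> X y -> f (x - y) = f x - f y,
      forall x, X x -> finite_set [set i | f x i <> 0],
      forall x i, X x -> D (f x i) &
      forall x, X x -> f x = 0 -> x = 0].
Proof.
have [FF FFP FFtot|A [goodA Amax]] := @Zorn_bigcup _ good.
  have dir B C : FF B -> FF C -> exists E, [/\ FF E, B `<=` E & C `<=` E].
    move=> FB FC; have [BC|CB] := FFtot _ _ FB FC; first by exists C; split.
    by exists B; split.
  split=> [p [B FB Bp]|p q [B FB Bp] [C FC Cq]|p [B FB Bp]].
  - have [+ _ _] := FFP _ FB => /(_ p Bp)[? ? ? pdom]; split=> // i /pdom[h Bh].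
    by exists h, B.
  - have [E [FE BE CE]] := dir _ _ FB FC; exists E => //.
    by have [_ + _] := FFP _ FE; apply; [exact: BE|exact: CE].
  - by have [_ _] := FFP _ FB; exact.
have [Apt AB A0] := goodA.
have AA0 : A 0.
  have [[p Ap]|nA] := pselect (A !=set0); first by rewrite -(subrr p); exact: AB.
  exfalso; apply: (Amax [set 0]).
    split=> [p Ap|/(_ 0 erefl) A00]; first by case: nA; exists p.
    by apply: nA; exists 0.
  split=> [p ->|p q -> ->|p ->] //=; last by rewrite subrr.
  split=> //; first exact: subgroup0.
  - by move=> i; exact: subgroup0.
  - by apply: (@sub_finite_set _ _ set0) => // i /=; apply.
have subA : subgroup A by exact: subgroupI.
have subdom : subgroup (dom A).
  apply: subgroupI; first by exists 0.
  by move=> x y [g Ag] [h Ah]; exists (g - h); exact: (AB _ _ Ag Ah).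
have ext x (g : Z -> T) : X x -> ~ dom A x -> (forall i, D (g i)) ->
    finite_set [set i | g i <> 0] -> (forall i, g i <> 0 -> dom A i \/ i = x) ->
    exists p (k : int), A p /\ ~ (p.1 + x *~ k = 0 <-> forall i, p.2 i + g i *~ k = 0).
  move=> Xx nx Dg fing gdom; apply: contrapT => noex.
  apply: Amax (good_extend goodA AA0 Xx Dg fing gdom _).
    split; first by move=> p Ap; exists p, 0; rewrite mulr0z addr0.
    move=> /(_ (x, g)) sub; apply: nx; exists g; apply: sub.
    by exists 0, 1; rewrite mulr1z add0r.
  by move=> p k Ap; apply: contrapT => nE; apply: noex; exists p, k.
suff domA x : X x -> dom A x.
  have /choice[f fP] x : exists g, X x -> A (x, g).
    by have [/domA[g Ag]|nx] := pselect (X x); [exists g|exists 0].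
  exists f; split=> [x y Xx Xy|x /fP/Apt[]//|x i /fP/Apt[_ + _ _]|x /fP/A0[_]//]; last exact.
    apply/eqP; rewrite -subr_eq0; apply/eqP.
    have XB := subgroupB subX Xx Xy.
    have [+ _] := A0 _ (AB _ _ (fP _ XB) (AB _ _ (fP _ Xx) (fP _ Xy))).
    by apply; rewrite /= subrr.
move=> Xx; apply: contrapT => nx.
have single d (x' : Z) : D d -> exists2 g : Z -> T, [/\ forall i, D (g i),
    finite_set [set i | g i <> 0] & forall i, g i <> 0 -> dom A i \/ i = x'] &
    g x' = d /\ forall i, i <> x' -> g i = 0.
  move=> Dd; pose g i : T := if i == x' then d else 0.
  have gx : g x' = d by rewrite /g eqxx.
  have g0 i : i <> x' -> g i = 0 by rewrite /g; case: eqP.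
  exists g; last by split.
  split=> [i||i gi].
  - by rewrite /g; case: ifP => // _; exact: subgroup0.
  - by apply: (@sub_finite_set _ _ [set x']) => // i gi; apply: contrapT => /g0.
  - by right; apply: contrapT => /g0.
have Asupp p i : A p -> ~ dom A i -> p.2 i = 0.
  by move=> /Apt[_ _ _ pdom] ni; apply: contrapT => /pdom.
have [[n [n0 nxA]]|nomul] := pselect (exists n, (0 < n)%N /\ dom A (x *+ n)); last first.
  have [c Dc cn0] := D_free.
  have [g [Dg fing gdom] [gx _]] := single c x Dc.
  have [p [k [Ap]]] := ext x g Xx nx Dg fing gdom; apply.
  have nmul (n : nat) : (0 < n)%N -> ~ dom A (x *+ n).
    by move=> n0 nA; apply: nomul; exists n.
  have [->|k0] := eqVneq k 0.
    rewrite mulr0z addr0 A0 //; split=> [-> i|p2]; first by rewrite mulr0z addr0.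
    by apply/funext => i; have := p2 i; rewrite mulr0z addr0.
  split=> [xk|/(_ x) hx]; exfalso.
    have : dom A (x *~ k).
      rewrite -[_ *~ _](addKr p.1) xk addr0; apply: subgroupN => //.
      by exists p.2; case: (p) Ap.
    case: (intP k) k0 => // m _; rewrite -?pmulrn; first exact: nmul.
    by rewrite mulrNz -pmulrn => /(subgroupN subdom); rewrite opprK; exact: nmul.
  move: hx; rewrite Asupp // add0r gx; case: (intP k) k0 => // m _; rewrite ?mulrNz -?pmulrn.
    exact: cn0.
  by move=> /eqP; rewrite oppr_eq0 => /eqP; exact: cn0.
have [l [x' [pl Xx' nx' lx']]] : exists (l : nat) x',
    [/\ prime l, X x', ~ dom A x' & dom A (x' *+ l)].
  have [|N /andP[N0 /asboolP NA] Nmin] :=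
      @ex_minnP (fun n => (0 < n)%N && `[< dom A (x *+ n) >]) _.
    by exists n; rewrite n0; exact/asboolP.
  have N1 : (1 < N)%N.
    by rewrite ltn_neqAle N0 andbT; apply/eqP => N1; apply: nx; rewrite -[x]mulr1n N1.
  exists (pdiv N), (x *+ (N %/ pdiv N)); split.
  - exact: pdiv_prime.
  - exact: subgroupMn.
  - move=> dA; have /Nmin : (0 < N %/ pdiv N)%N && `[< dom A (x *+ (N %/ pdiv N)) >].
      by rewrite divn_gt0 ?pdiv_gt0 // pdiv_leq //; exact/asboolP.
    by rewrite leqNgt ltn_Pdiv // prime_gt1 // pdiv_prime.
  - by rewrite -mulrnA divnK // pdiv_dvd.
have domk p (k : int) y : A p -> p.1 + y *~ k = 0 -> dom A (y *~ k).
  move=> Ap yk; rewrite -[_ *~ _](addKr p.1) yk addr0; apply: subgroupN => //.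
  by exists p.2; case: (p) Ap.
have [[t [Xt nt tl]]|notor] := pselect (exists t, [/\ X t, ~ dom A t & t *+ l = 0]).
  have [d Dd [d0 dl]] := D_torsion pl.
  have [g [Dg fing gdom] [gt g0]] := single d t Dd.
  have [p [k [Ap]]] := ext t g Xt nt Dg fing gdom; apply.
  have [/dvdzP[m ->]|lk] := boolP (l %| k)%Z.
    rewrite mulrC mulrzA -pmulrn tl mul0rz addr0 A0 //.
    have gl i : g i *~ (l%:Z * m) = 0.
      have [->|/g0->] := pselect (i = t); last by rewrite mul0rz.
      by rewrite gt mulrzA -pmulrn dl mul0rz.
    split=> [-> i|p2]; first by rewrite gl addr0.
    by apply/funext => i; have := p2 i; rewrite gl addr0.
  have dt : dom A (t *+ l) by rewrite tl; exists 0.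
  split=> [/(domk _ _ _ Ap) kt|/(_ t) ht]; exfalso.
    exact/nt/(subgroup_Bezout subdom pl lk dt kt).
  move: ht; rewrite Asupp // add0r gt => kd.
  have sub0 : subgroup [set (0 : T)].
    by apply: subgroupI => // y z -> ->; rewrite subrr.
  exact/d0/(subgroup_Bezout sub0 pl lk dl kd).
have [d Ad] := lx'; have [_ Dd find ddom] := Apt _ Ad.
have /choice[e eP] i : exists e, [/\ D e, e *+ l = d i & d i = 0 -> e = 0].
  have [->|di] := eqVneq (d i) 0; first by exists 0; rewrite mul0rn; split=> //; exact: subgroup0.
  have [y Dy yl] := D_root (prime_gt0 pl) (Dd i).
  by exists y; split=> // di0; rewrite di0 eqxx in di.
have esupp i : e i <> 0 -> d i <> 0 by have [_ _ e0] := eP i => + /e0.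
have [p [k [Ap]]] := ext x' e Xx' nx' (fun i => let: And3 Dei _ _ := eP i in Dei)
  (sub_finite_set (fun i => esupp i) find) (fun i ei => or_introl (ddom i (esupp i ei))).
apply.
have [/dvdzP[m ->]|lk] := boolP (l %| k)%Z.
  have lw (z : Z) : z *~ (m * l%:Z) = z *+ l *~ m by rewrite mulrC mulrzA -pmulrn.
  have := A0 _ (subgroupD subA Ap (subgroupMz subA m Ad)); rewrite /= mulz_fst /=.
  have ee i : e i *~ (m * l%:Z) = d i *~ m.
    by have [_ <- _] := eP i; rewrite mulrC mulrzA -pmulrn.
  have pd i : (p.2 + ((x' *+ l, d) *~ m).2) i = p.2 i + d i *~ m.
    by rewrite -[LHS]/(p.2 i + _) mulz_snd.
  rewrite lw => ->; split=> [h i|h]; first by rewrite ee -pd h.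
  by apply/funext => i; rewrite pd -ee h.
split=> [/(domk _ _ _ Ap) kx|h]; exfalso.
  exact/nx'/(subgroup_Bezout subdom pl lk lx' kx).
have sub2 : subgroup [set f : Z -> T | exists y, A (y, f)].
  apply: subgroupI; first by exists 0.
  by move=> f f' [y Ay] [y' Ay']; exists (y - y'); exact: (AB _ _ Ay Ay').
have el : e *+ l = d.
  apply/funext => i; have [_ <- _] := eP i.
  by elim: (l) => [|n' IH]; rewrite ?mulr0n // !mulrS -IH.
have [y Aye] : [set f : Z -> T | exists y, A (y, f)] e.
  apply: (subgroup_Bezout sub2 pl lk); first by rewrite el; exists (x' *+ l).
  exists (- p.1); suff -> : e *~ k = - p.2 by exact: (subgroupN subA Ap).
  apply/eqP; rewrite -addr_eq0 addrC; apply/eqP/funext => i.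
  by rewrite -[LHS]/(p.2 i + _) mulz_fct; exact: h.
apply: notor; exists (x' - y); split.
- by apply: subgroupB => //; have [] := Apt _ Aye.
- move=> dxy; apply: nx'; rewrite -[x'](subrK y); apply: subgroupD => //.
  by exists e.
- rewrite mulrnBl; have [_] := A0 _ (AB _ _ Ad (subgroupMz subA l Aye)).
  rewrite /= mulz_fst; apply; apply/funext => i.
  rewrite -[LHS]/(d i - _) mulz_snd /= -pmulrn; have [_ -> _] := eP i.
  by rewrite subrr.
Qed.

End embedding.

(** * Ultralimits and invariant means *)

Definition bounded_map (R : realType) (T : Type) (f : T -> R) := exists M, forall x, `|f x| <= M.

Section bounded_map.
Context {R : realType} {T : Type}.
Implicit Types f g : T -> R.

Lemma bounded_map_cst (a : R) : bounded_map (fun _ : T => a).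
Proof. by exists `|a|. Qed.

Lemma bounded_mapD f g : bounded_map f -> bounded_map g -> bounded_map (fun x => f x + g x).
Proof.
by move=> [M fM] [M' gM]; exists (M + M') => x; apply: le_trans (ler_normD _ _) _; exact: lerD.
Qed.

Lemma bounded_mapM f g : bounded_map f -> bounded_map g -> bounded_map (fun x => f x * g x).
Proof.
by move=> [M fM] [M' gM]; exists (M * M') => x; rewrite normrM; apply: ler_pM.
Qed.

Lemma bounded_mapB f g : bounded_map f -> bounded_map g -> bounded_map (fun x => f x - g x).
Proof.
by move=> [M fM] [M' gM]; exists (M + M') => x; apply: le_trans (ler_normB _ _) _; exact: lerD.
Qed.

Lemma bounded_map_comp (S : Type) (h : S -> T) f : bounded_map f -> bounded_map (fun x => f (h x)).
Proof. by move=> [M fM]; exists M => x. Qed.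

End bounded_map.

Section ultralimits.
Context {R : realType} {I : Type} {U : set_system I} {UU : UltraFilter U}.
Implicit Types f g : I -> R.

Definition ulim f : R := lim (f @ U).

(** The closed interval containing the values is compact. *)
Lemma cvg_ulim f : bounded_map f -> f @ U --> ulim f.
Proof.
move=> [M fM]; have [|l [_ fl]] := @segment_compact R (- M) M (f @ U) _.
  by apply: (@filterE _ U) => i /=; rewrite in_itv /= -ler_norml.
suff cvl : f @ U --> l by apply: (cvgP l cvl).
move=> A lA; have [//|UnA] := in_ultra_setVsetC (f @^-1` A) UU.
by have [x [nAx /nAx]] := fl (~` A) A UnA lA.
Qed.

Lemma ulimE f l : f @ U --> l -> ulim f = l.
Proof. exact/cvg_lim/Rhausdorff. Qed.

Lemma ulimD f g : bounded_map f -> bounded_map g ->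
  ulim (fun i => f i + g i) = ulim f + ulim g.
Proof. by move=> /cvg_ulim fl /cvg_ulim gl; apply: ulimE; exact: cvgD. Qed.

Lemma ulimM f g : bounded_map f -> bounded_map g ->
  ulim (fun i => f i * g i) = ulim f * ulim g.
Proof. by move=> /cvg_ulim fl /cvg_ulim gl; apply: ulimE; exact: cvgM. Qed.

Lemma ulim_cst (a : R) : ulim (fun=> a) = a.
Proof. by apply: ulimE; exact: cvg_cst. Qed.

Lemma ulim_ge0 f : bounded_map f -> (forall i, 0 <= f i) -> 0 <= ulim f.
Proof.
by move=> /cvg_ulim fl f0; apply: (limr_ge (cvgP _ fl)); exact: nearW.
Qed.

End ultralimits.

(** The index [(Y, n)] stands for the box of all sums of multiples [y *+ k] with [y] in
[Y] and [k <= n]. *)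
Definition net_filter (N : choiceType) : set_system (seq N * nat) := filter_from setT
  (fun p : seq N * nat => [set q : seq N * nat | {subset p.1 <= q.1} /\ (p.2 <= q.2)%N]).

Lemma net_filter_proper (N : choiceType) : ProperFilter (@net_filter N).
Proof.
apply: filter_from_proper; last by move=> p _; exists p; split.
apply: filter_from_filter; first by exists ([::], 0%N).
move=> p q _ _; exists (p.1 ++ q.1, maxn p.2 q.2) => // r /= [pqr nr]; split; split.
- by move=> y yp; apply: pqr; rewrite mem_cat yp.
- by apply: leq_trans nr; exact: leq_maxl.
- by move=> y yp; apply: pqr; rewrite mem_cat yp orbT.
- by apply: leq_trans nr; exact: leq_maxr.
Qed.

Section averages.
Context {R : realType} {N : zmodType}.
Implicit Types (f g : N -> R) (Y : seq N).

Fixpoint box_average Y (n : nat) f : R :=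
  if Y is y :: Y' then
    n.+1%:R^-1 * \sum_(k < n.+1) box_average Y' n (fun x => f (x + y *+ k))
  else f 0.

Lemma box_averageD Y n f g (a : R) :
  box_average Y n (fun x => a * f x + g x) = a * box_average Y n f + box_average Y n g.
Proof.
elim: Y f g => //= y Y IH f g; rewrite [a * (_ * _)]mulrCA -mulrDr; congr (_ * _).
by rewrite mulr_sumr -big_split /=; apply: eq_bigr => k _; rewrite IH.
Qed.

Lemma box_average_cst Y n (a : R) : box_average Y n (fun=> a) = a.
Proof.
elim: Y => //= y Y ->.
by rewrite sumr_const card_ord -[a *+ _]mulr_natl mulrA mulVf ?mul1r ?pnatr_eq0.
Qed.

Lemma box_average_ge0 Y n f : (forall x, 0 <= f x) -> 0 <= box_average Y n f.
Proof.
elim: Y f => //= y Y IH f f0; rewrite mulr_ge0 ?invr_ge0 ?ler0n //.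
by apply: sumr_ge0 => k _; exact: IH.
Qed.

Lemma box_average_le Y n f M : (forall x, `|f x| <= M) -> `|box_average Y n f| <= M.
Proof.
move=> fM; have le g : (forall x, g x <= M) -> box_average Y n g <= M.
  move=> gM; rewrite -subr_ge0 -[X in X - _](box_average_cst Y n) addrC -mulN1r -box_averageD.
  by apply: box_average_ge0 => x; rewrite mulN1r addrC subr_ge0.
rewrite ler_norml; apply/andP; split; last first.
  by apply: le => x; apply: le_trans (fM x); exact: ler_norm.
rewrite lerNl -mulN1r -[leLHS]addr0 -[X in _ + X](box_average_cst Y n 0) -box_averageD.
by apply: le => x; rewrite mulN1r addr0; apply: le_trans (fM x); rewrite -normrN; exact: ler_norm.
Qed.

(** In the direction [y] the average telescopes, up to the two ends of the box. *)
Lemma box_average_shift Y n f M y : (forall x, `|f x| <= M) -> y \in Y ->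
  `|box_average Y n (fun x => f (x + y) - f x)| <= 2 * M / n.+1%:R.
Proof.
have averageB Z g h : box_average Z n (fun x => g x - h x) = box_average Z n g - box_average Z n h.
  rewrite addrC -mulN1r -box_averageD; congr box_average; apply/funext => x.
  by rewrite mulN1r addrC.
elim: Y f => //= z Y IH f fM; rewrite inE => /predU1P[<-|yY].
  rewrite [X in _^-1 * X](_ : _ = box_average Y n (fun x => f (x + y *+ n.+1)) -
      box_average Y n (fun x => f (x + y *+ 0))).
    rewrite mulrC normrM normfV (ger0_norm (ler0n _ _)) ler_pM2r ?invr_gt0 ?ltr0n //.
    rewrite mulr_natl mulr2n; apply: le_trans (ler_normB _ _) _.
    by apply: lerD; exact: box_average_le.
  rewrite -(telescope_sumr (fun k => box_average Y n (fun x => f (x + y *+ k)))) // big_mkord.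
  apply: eq_bigr => k _; rewrite averageB; congr (box_average _ _ _ - _).
  by apply/funext => x; rewrite mulrSr addrA.
rewrite normrM normfV (ger0_norm (ler0n _ _)) mulrC ler_pdivrMr ?ltr0n //.
apply: le_trans (ler_norm_sum _ _ _) _.
apply: (@le_trans _ _ (\sum_(k < n.+1) (2 * M / n.+1%:R))).
  apply: ler_sum => k _.
  rewrite (_ : (fun x => _) = fun x => f (x + y + z *+ k) - f (x + z *+ k)).
    by apply: (IH (fun x => f (x + z *+ k))).
  by apply/funext => x; rewrite [x + y + _]addrAC.
by rewrite sumr_const card_ord -[leLHS]mulr_natr.
Qed.

End averages.

Definition invariant_mean (R : realType) (N : zmodType) (m : (N -> R) -> R) := [/\
    forall (a : R) f g, bounded_map f -> bounded_map g ->
      m (fun x => a * f x + g x) = a * m f + m g,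
    forall f, bounded_map f -> (forall x, 0 <= f x) -> 0 <= m f,
    forall a, m (fun=> a) = a &
    forall f a, bounded_map f -> m (fun x => f (x + a)) = m f].

(** The mean is the ultralimit of the averages over larger and larger boxes. *)
Theorem invariant_mean_exists (R : realType) (N : zmodType) :
  exists m : (N -> R) -> R, invariant_mean m.
Proof.
have [U [UU NU]] := ultraFilterLemma (net_filter_proper N).
have bA (f : N -> R) : bounded_map f -> bounded_map (fun i : seq N * nat => box_average i.1 i.2 f).
  by move=> [M fM]; exists M => i; exact: box_average_le.
exists (fun f => ulim (U := U) (fun i => box_average i.1 i.2 f)); split.
- move=> a f g bf bg; under [X in ulim X]funext do rewrite box_averageD.
  have [bAf bAg] := (bA f bf, bA g bg).
  have bca : bounded_map (fun _ : seq N * nat => a) by exact: bounded_map_cst.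
  by rewrite ulimD ?ulimM ?ulim_cst //; exact: bounded_mapM.
- by move=> f bf f0; apply: ulim_ge0; [exact: bA|move=> i; exact: box_average_ge0].
- by move=> a; under [X in ulim X]funext do rewrite box_average_cst; rewrite ulim_cst.
- move=> f a bf; have [M fM] := bf.
  have -> : (fun i : seq N * nat => box_average i.1 i.2 (fun x => f (x + a))) =
      (fun i => box_average i.1 i.2 (fun x => f (x + a) - f x) + box_average i.1 i.2 f).
    apply/funext => i; rewrite -[X in X + _]mul1r -box_averageD; congr box_average.
    by apply/funext => x; rewrite mul1r subrK.
  have bfa : bounded_map (fun x => f (x + a)) by exact: (bounded_map_comp (fun x => x + a)).
  rewrite ulimD; [|by apply: bA; exact: bounded_mapB|exact: bA].
  rewrite (_ : ulim _ = 0) ?add0r //; apply: ulimE; apply/cvgrPdist_lt => e e0.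
  have [n ne] : exists n : nat, 2 * M / e < n.+1%:R.
    exists (Num.truncn (2 * M / e)); exact: truncnS_gt.
  have : U [set q : seq N * nat | {subset [:: a] <= q.1} /\ (n <= q.2)%N].
    by apply: NU; exists ([:: a], n).
  apply: filterS => -[Y n'] /= [aY nn']; rewrite sub0r normrN.
  apply: le_lt_trans (box_average_shift n' fM (aY _ (mem_head _ _))) _.
  rewrite ltr_pdivrMr ?ltr0n // [e * _]mulrC -ltr_pdivrMr //.
  by apply: lt_le_trans ne _; rewrite ler_nat ltnS.
Qed.

(** For [z Y n] depending on a finite set [Y] and a precision [n], the pointwise
ultralimit [chi] is approximated on each finite set by [z Y' n'] with [Y'] and [n']
as large as desired. *)
Lemma circle_ultralimit (R : realType) (N : choiceType)
    (z : seq N -> nat -> N -> circle (R := R)) :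
  exists chi : N -> circle (R := R), forall (Y : seq N) (n : nat) (e : R), 0 < e ->
    exists Y' n', [/\ {subset Y <= Y'}, (n <= n')%N &
      forall y, y \in Y -> 1 - re (z Y' n' y - chi y) < e].
Proof.
have [U [UU NU]] := ultraFilterLemma (net_filter_proper N).
have FU : Filter U by apply: filter_filter.
pose a y (i : seq N * nat) := Re (cval (z i.1 i.2 y)).
pose b y (i : seq N * nat) := Im (cval (z i.1 i.2 y)).
have ab y i : a y i * a y i + b y i * b y i = 1.
  by rewrite -!expr2; exact: normsq_circle.
have ba y : bounded_map (a y).
  by exists 1 => i; rewrite ler_norml; have := ab y i; nra.
have bb y : bounded_map (b y).
  by exists 1 => i; rewrite ler_norml; have := ab y i; nra.
have circ y : normsq (Complex (ulim (U := U) (a y)) (ulim (U := U) (b y))) == 1.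
  rewrite /normsq /= !expr2 -!ulimM // -ulimD; [|exact: bounded_mapM|exact: bounded_mapM].
  by under [X in ulim X]funext do rewrite ab; rewrite ulim_cst.
pose chi y : circle (R := R) := exist (fun w : R[i] => normsq w == 1) _ (circ y).
exists chi => Y n e e0.
have near y : U [set i | 1 - re (z i.1 i.2 y - chi y) < e].
  have d0 : 0 < Num.sqrt e by rewrite sqrtr_gt0.
  have cva : a y @ U --> ulim (U := U) (a y) by exact: cvg_ulim.
  have na : \forall i \near U, `|ulim (U := U) (a y) - a y i| < Num.sqrt e.
    exact: (cvgr_dist_lt _ _ cva _ d0).
  have cvb : b y @ U --> ulim (U := U) (b y) by exact: cvg_ulim.
  have nb : \forall i \near U, `|ulim (U := U) (b y) - b y i| < Num.sqrt e.
    exact: (cvgr_dist_lt _ _ cvb _ d0).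
  have := @filterI _ U FU _ _ na nb; apply: (@filterS _ U FU) => i [/= ai bi].
  have := normsq_circle_sub (z i.1 i.2 y) (chi y).
  have -> : cval (chi y) = Complex (ulim (U := U) (a y)) (ulim (U := U) (b y)) by [].
  have sq (x : R) : `|x| < Num.sqrt e -> x ^+ 2 < e.
    move=> xe; rewrite -(real_normK (num_real x)) -[X in _ < X]sqr_sqrtr ?ltW //.
    by rewrite ltr_pXn2r ?nnegrE ?normr_ge0 ?sqrtr_ge0.
  move: ai bi => /sq; rewrite /a => ai /sq; rewrite /b => bi.
  rewrite /normsq; case: (cval (z i.1 i.2 y)) ai bi => c d /= ai bi; nra.
have nearY : U [set i | forall y, y \in Y -> 1 - re (z i.1 i.2 y - chi y) < e].
  elim: Y => [|y Y IH]; first exact: filterE.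
  have := @filterI _ U FU _ _ (near y) IH; apply: (@filterS _ U FU) => i [/= iy iY] y'.
  by rewrite inE => /predU1P[->//|]; exact: iY.
have : U [set q : seq N * nat | {subset Y <= q.1} /\ (n <= q.2)%N].
  by apply: NU; exists (Y, n).
have PU : ProperFilter U := ultra_proper.
move=> /(filterI nearY)/filter_ex[[Y' n'] [/= zY [YY' nn']]].
by exists Y', n'; split.
Qed.

(** * The mean square norm *)

Section invariant_mean_theory.
Context {R : realType} {N : zmodType} (m : (N -> R) -> R) (mP : invariant_mean m).
Implicit Types f g : N -> R.

Lemma meanZ (a : R) f : bounded_map f -> m (fun x => a * f x) = a * m f.
Proof.
move=> bf; have [lin _ cst _] := mP; have := lin a f _ bf (bounded_map_cst 0).
by rewrite cst addr0 => <-; congr m; apply/funext => x; rewrite addr0.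
Qed.

Lemma meanD f g : bounded_map f -> bounded_map g -> m (fun x => f x + g x) = m f + m g.
Proof.
move=> bf bg; have [lin _ _ _] := mP; rewrite -[m f]mul1r -lin //.
by congr m; apply/funext => x; rewrite mul1r.
Qed.

Lemma meanB f g : bounded_map f -> bounded_map g -> m (fun x => f x - g x) = m f - m g.
Proof.
move=> bf bg; have [lin _ _ _] := mP; rewrite addrC -mulN1r -lin //.
by congr m; apply/funext => x; rewrite mulN1r addrC.
Qed.

Lemma mean_ge0 f : bounded_map f -> (forall x, 0 <= f x) -> 0 <= m f.
Proof. by have [_ ge0 _ _] := mP; exact: ge0. Qed.

Lemma mean_le f g : bounded_map f -> bounded_map g -> (forall x, f x <= g x) -> m f <= m g.
Proof.
move=> bf bg fg; rewrite -subr_ge0 -meanB //; apply: mean_ge0; first exact: bounded_mapB.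
by move=> x; rewrite subr_ge0.
Qed.

Lemma mean_cst a : m (fun=> a) = a. Proof. by have [_ _ cst _] := mP. Qed.

Lemma mean_shift f a : bounded_map f -> m (fun x => f (x + a)) = m f.
Proof. by have [_ _ _ shift] := mP; exact: shift. Qed.

Lemma bounded_map_sum (I : Type) (t : seq I) (f : I -> N -> R) :
  (forall i, bounded_map (f i)) -> bounded_map (fun x => \sum_(i <- t) f i x).
Proof.
move=> bf; elim: t => [|i t IH].
  by under eq_fun do rewrite big_nil; exact: bounded_map_cst.
by under eq_fun do rewrite big_cons; exact: bounded_mapD.
Qed.

Lemma mean_sum (I : Type) (t : seq I) (f : I -> N -> R) :
  (forall i, bounded_map (f i)) ->
  m (fun x => \sum_(i <- t) f i x) = \sum_(i <- t) m (f i).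
Proof.
move=> bf; elim: t => [|i t IH].
  by under [X in m X]funext do rewrite big_nil; rewrite big_nil mean_cst.
under [X in m X]funext do rewrite big_cons.
by rewrite meanD ?big_cons ?IH //; exact: bounded_map_sum.
Qed.

Lemma sqr_mean_le f : bounded_map f -> m f ^+ 2 <= m (fun x => f x ^+ 2).
Proof.
move=> bf; have bf2 : bounded_map (fun x => f x ^+ 2) by exact: bounded_mapM.
have b2 : bounded_map (fun x => (- 2 * m f) * f x + (m f) ^+ 2).
  apply: bounded_mapD; last exact: bounded_map_cst.
  by apply: bounded_mapM => //; exact: bounded_map_cst.
have : 0 <= m (fun x => f x ^+ 2 + ((- 2 * m f) * f x + (m f) ^+ 2)).
  apply: mean_ge0 => [|x]; first exact: bounded_mapD.
  by rewrite (_ : _ + _ = (f x - m f) ^+ 2) ?sqr_ge0 //; ring.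
have [lin _ _ _] := mP.
rewrite meanD // lin //; last exact: bounded_map_cst.
by rewrite mean_cst; nra.
Qed.

End invariant_mean_theory.

Section L2.
Context {R : realType} {N : zmodType} (m : (N -> R) -> R) (mP : invariant_mean m).
Implicit Types (v w : N -> R[i]) (y : N) (c : circle (R := R)).

Definition cbounded v := bounded_map (fun x => Re (v x)) /\ bounded_map (fun x => Im (v x)).

Definition nrm2 v : R := m (fun x => normsq (v x)).

Lemma bounded_normsq v : cbounded v -> bounded_map (fun x => normsq (v x)).
Proof. by move=> [bRe bIm]; apply: bounded_mapD; exact: bounded_mapM. Qed.

Lemma cboundedD v w : cbounded v -> cbounded w -> cbounded (fun x => v x + w x).
Proof.
move=> [a b] [c d]; split.
  by under eq_fun do rewrite raddfD; exact: bounded_mapD.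
by under eq_fun do rewrite raddfD; exact: bounded_mapD.
Qed.

Lemma cboundedB v w : cbounded v -> cbounded w -> cbounded (fun x => v x - w x).
Proof.
move=> [a b] [c d]; split.
  by under eq_fun do rewrite raddfB; exact: bounded_mapB.
by under eq_fun do rewrite raddfB; exact: bounded_mapB.
Qed.

Lemma ReM (z w : R[i]) : Re (z * w) = Re z * Re w - Im z * Im w.
Proof. by case: z w => ? ? [? ?]. Qed.
Lemma ImM (z w : R[i]) : Im (z * w) = Re z * Im w + Im z * Re w.
Proof. by case: z w => ? ? [? ?]. Qed.

Lemma cboundedM v w : cbounded v -> cbounded w -> cbounded (fun x => v x * w x).
Proof.
move=> [a b] [c d]; split.
  by under eq_fun do rewrite ReM; apply: bounded_mapB; exact: bounded_mapM.
by under eq_fun do rewrite ImM; apply: bounded_mapD; exact: bounded_mapM.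
Qed.

Lemma cbounded_unit v : (forall x, normsq (v x) = 1) -> cbounded v.
Proof.
move=> v1; split; exists 1 => x; have := v1 x; rewrite /normsq ler_norml => h;
  by apply/andP; split; nra.
Qed.

Lemma cbounded_cst (z : R[i]) : cbounded (fun=> z).
Proof. by split; exact: bounded_map_cst. Qed.

Lemma cboundedZ (z : R[i]) v : cbounded v -> cbounded (fun x => z * v x).
Proof. by move=> bv; apply: cboundedM => //; exact: cbounded_cst. Qed.

Lemma cbounded_shift v y : cbounded v -> cbounded (fun x => v (x + y)).
Proof.
by move=> [a b]; split; [exact: (bounded_map_comp (fun x => x + y) a)|
  exact: (bounded_map_comp (fun x => x + y) b)].
Qed.

Lemma nrm2_ge0 v : cbounded v -> 0 <= nrm2 v.
Proof. by move=> bv; apply: mean_ge0 => // [|x]; [exact: bounded_normsq|exact: normsq_ge0]. Qed.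

Lemma nrm2_shift v y : cbounded v -> nrm2 (fun x => v (x + y)) = nrm2 v.
Proof.
by move=> bv; apply: (mean_shift mP (f := fun x => normsq (v x))); exact: bounded_normsq.
Qed.

Lemma nrm2Z (z : R[i]) v : cbounded v -> nrm2 (fun x => z * v x) = normsq z * nrm2 v.
Proof.
move=> bv; rewrite -meanZ //; last exact: bounded_normsq.
by congr m; apply/funext => x; rewrite normsqM.
Qed.

Lemma nrm2_rotate c v : cbounded v -> nrm2 (fun x => cval c * v x) = nrm2 v.
Proof. by move=> bv; rewrite nrm2Z // normsq_circle mul1r. Qed.

Lemma nrm2_parallelogram v w : cbounded v -> cbounded w ->
  nrm2 (fun x => v x + w x) + nrm2 (fun x => v x - w x) = 2 * nrm2 v + 2 * nrm2 w.
Proof.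
move=> bv bw; have [bv2 bw2] := (bounded_normsq bv, bounded_normsq bw).
rewrite -meanD //; [|exact/bounded_normsq/cboundedD|exact/bounded_normsq/cboundedB].
rewrite -!meanZ // -meanD //;
  try by apply: bounded_mapM => //; exact: bounded_map_cst.
by congr m; apply/funext => x; rewrite normsq_parallelogram.
Qed.

Lemma nrm2B_le v w : cbounded v -> cbounded w ->
  nrm2 (fun x => v x - w x) <= 2 * nrm2 v + 2 * nrm2 w.
Proof.
by move=> bv bw; rewrite -nrm2_parallelogram // lerDr nrm2_ge0 //; exact: cboundedD.
Qed.

Lemma nrm2D_le v w : cbounded v -> cbounded w ->
  nrm2 (fun x => v x + w x) <= 2 * nrm2 v + 2 * nrm2 w.
Proof.
by move=> bv bw; rewrite -nrm2_parallelogram // lerDl nrm2_ge0 //; exact: cboundedB.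
Qed.

End L2.

(** * Approximate eigenvectors of translations *)

Section convolution.
Context {R : realType} {N : zmodType} (m : (N -> R) -> R) (mP : invariant_mean m).
Implicit Types (k : N -> R) (v w : N -> R[i]) (y : N) (c : circle (R := R)).

Definition conv k v : N -> R[i] := fun x =>
  Complex (m (fun t => k (x - t) * Re (v t))) (m (fun t => k (x - t) * Im (v t))).

Let bk k (f : N -> R) x : bounded_map k -> bounded_map f -> bounded_map (fun t => k (x - t) * f t).
Proof.
move=> bk bf; apply: bounded_mapM => //.
exact: (bounded_map_comp (fun t => x - t) bk).
Qed.

Lemma convD k v w : bounded_map k -> cbounded v -> cbounded w ->
  conv k (fun x => v x + w x) = fun x => conv k v x + conv k w x.
Proof.
move=> bdk [bv bv'] [bw bw']; apply/funext => x; rewrite /conv.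
by congr Complex; rewrite -(meanD mP); try (by apply: bk);
  congr m; apply/funext => t; rewrite raddfD /= mulrDr.
Qed.

Lemma convB k v w : bounded_map k -> cbounded v -> cbounded w ->
  conv k (fun x => v x - w x) = fun x => conv k v x - conv k w x.
Proof.
move=> bdk [bv bv'] [bw bw']; apply/funext => x; rewrite /conv.
by congr Complex; rewrite -(meanB mP); try (by apply: bk);
  congr m; apply/funext => t; rewrite raddfB /= mulrBr.
Qed.

Lemma convZ k (z : R[i]) v : bounded_map k -> cbounded v ->
  conv k (fun x => z * v x) = fun x => z * conv k v x.
Proof.
move=> bdk [bv bv']; apply/funext => x; rewrite /conv; case: z => a b /=.
have sc (a' : R) f : bounded_map f -> bounded_map (fun t => a' * f t).
  by move=> bf; apply: bounded_mapM => //; exact: bounded_map_cst.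
apply/eqP; rewrite eq_complex /=; apply/andP; split; apply/eqP.
  rewrite -!(meanZ mP); try (by apply: bk).
  rewrite -(meanB mP); try (by apply: sc; apply: bk).
  by congr m; apply/funext => t; rewrite ReM /=; ring.
rewrite -!(meanZ mP); try (by apply: bk).
rewrite -(meanD mP); try (by apply: sc; apply: bk).
by congr m; apply/funext => t; rewrite ImM /=; ring.
Qed.

Lemma conv_shift k v y : bounded_map k -> cbounded v ->
  conv k (fun x => v (x + y)) = fun x => conv k v (x + y).
Proof.
move=> bdk [bv bv']; apply/funext => x; rewrite /conv; congr Complex.
  rewrite -[RHS](mean_shift mP y); last exact: bk.
  by congr m; apply/funext => t; rewrite opprD addrACA subrr addr0.
rewrite -[RHS](mean_shift mP y); last exact: bk.
by congr m; apply/funext => t; rewrite opprD addrACA subrr addr0.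
Qed.

Lemma conv_kernelB k k' v : bounded_map k -> bounded_map k' -> cbounded v ->
  conv (fun x => k x - k' x) v = fun x => conv k v x - conv k' v x.
Proof.
move=> bdk bdk' [bv bv']; apply/funext => x; rewrite /conv.
by congr Complex; rewrite -(meanB mP); try (by apply: bk);
  congr m; apply/funext => t; rewrite mulrBl.
Qed.

Lemma conv_kernel_shift k v y : conv (fun x => k (x + y)) v = fun x => conv k v (x + y).
Proof.
by apply/funext => x; rewrite /conv; congr Complex; congr m; apply/funext => t; rewrite addrAC.
Qed.

Let sqr_bound k (f : N -> R) M x : bounded_map f -> (forall x, `|k x| <= M) ->
  m (fun t => k (x - t) * f t) ^+ 2 <= M ^+ 2 * m (fun t => f t ^+ 2).
Proof.
move=> bf kM; have bdk : bounded_map k by exists M.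
apply: le_trans (sqr_mean_le mP (bk _ bdk bf)) _.
have bf2 : bounded_map (fun t => f t ^+ 2) by exact: bounded_mapM.
rewrite -(meanZ mP) //; apply: (mean_le mP) => [||t].
- by apply: bounded_mapM; exact: bk.
- by apply: bounded_mapM => //; exact: bounded_map_cst.
- rewrite exprMn ler_wpM2r ?sqr_ge0 // -(real_normK (num_real (k _))).
  by rewrite lerXn2r ?nnegrE // (le_trans _ (kM 0)).
Qed.

Let normsq_conv_le k v M x : cbounded v -> (forall x, `|k x| <= M) ->
  normsq (conv k v x) <= M ^+ 2 * nrm2 m v.
Proof.
move=> [bv bv'] kM; rewrite /nrm2 /normsq (meanD mP) /=; [|exact: bounded_mapM|exact: bounded_mapM].
by rewrite mulrDr lerD //; exact: sqr_bound.
Qed.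

Lemma cbounded_conv k v : bounded_map k -> cbounded v -> cbounded (conv k v).
Proof.
move=> bdk bv; have [M kM] := bdk.
have le (a b : R) : a ^+ 2 + b ^+ 2 <= M ^+ 2 * nrm2 m v ->
    `|a| <= 1 + M ^+ 2 * nrm2 m v /\ `|b| <= 1 + M ^+ 2 * nrm2 m v.
  by rewrite !ler_norml; set C := _ * nrm2 m v => h; split; apply/andP; split; nra.
by split; exists (1 + M ^+ 2 * nrm2 m v) => x; have [] := le _ _ (normsq_conv_le x bv kM).
Qed.

(** Applied to the kernel [k (x + y) - k x], this bound makes convolution smoothing:
it compares [conv k v] with its translates uniformly in [v]. *)
Lemma nrm2_conv_le k v M : cbounded v -> (forall x, `|k x| <= M) ->
  nrm2 m (conv k v) <= M ^+ 2 * nrm2 m v.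
Proof.
move=> bv kM; have bdk : bounded_map k by exists M.
rewrite -[leRHS](mean_cst mP); apply: (mean_le mP) => [||x].
- exact/bounded_normsq/cbounded_conv.
- exact: bounded_map_cst.
- exact: normsq_conv_le.
Qed.

End convolution.

Section joint_eigenvectors.
Context {R : realType} {N : zmodType} (m : (N -> R) -> R) (mP : invariant_mean m).
Implicit Types (v w : N -> R[i]) (y : N) (c : circle (R := R)) (Q : (N -> R[i]) -> R).

(** These properties hold for the mean square norm, are inherited under operators that
commute with translations, and pass to differences, even indefinite ones. *)
Definition invariant_form Q := [/\
  forall v w, cbounded v -> cbounded w ->
    Q (fun x => v x + w x) + Q (fun x => v x - w x) = 2 * Q v + 2 * Q w,
  forall v y, cbounded v -> Q (fun x => v (x + y)) = Q v &
  forall v c, cbounded v -> Q (fun x => cval c * v x) = Q v].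

Lemma invariant_form_nrm2 : invariant_form (nrm2 m).
Proof.
split=> [v w bv bw|v y bv|v c bv].
- exact: nrm2_parallelogram.
- exact: nrm2_shift.
- exact: nrm2_rotate.
Qed.

Lemma invariant_form_comp Q (L : (N -> R[i]) -> N -> R[i]) : invariant_form Q ->
  (forall v, cbounded v -> cbounded (L v)) ->
  (forall v w, cbounded v -> cbounded w -> L (fun x => v x + w x) = fun x => L v x + L w x) ->
  (forall v w, cbounded v -> cbounded w -> L (fun x => v x - w x) = fun x => L v x - L w x) ->
  (forall v y, cbounded v -> L (fun x => v (x + y)) = fun x => L v (x + y)) ->
  (forall v c, cbounded v -> L (fun x => cval c * v x) = fun x => cval c * L v x) ->
  invariant_form (fun v => Q (L v)).
Proof.
move=> [QP Qs Qr] Lb LD LB Ls Lr; split=> [v w bv bw|v y bv|v c bv].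
- by rewrite LD // LB // QP //; exact: Lb.
- by rewrite Ls // Qs //; exact: Lb.
- by rewrite Lr // Qr //; exact: Lb.
Qed.

Lemma invariant_formB Q Q' (a : R) : invariant_form Q -> invariant_form Q' ->
  invariant_form (fun v => Q v - a * Q' v).
Proof.
move=> [QP Qs Qr] [QP' Qs' Qr']; split=> [v w bv bw|v y bv|v c bv].
- rewrite (_ : _ + _ = (Q (fun x => v x + w x) + Q (fun x => v x - w x)) -
      a * (Q' (fun x => v x + w x) + Q' (fun x => v x - w x))); last by ring.
  by rewrite QP // QP' //; ring.
- by rewrite Qs // Qs'.
- by rewrite Qr // Qr'.
Qed.

(** Let [u] be the translation by [y].  Then [w'] is the geometric sum of the
[c^k u^k w] for [k < 2 ^ s], written as a product of factors [1 + c^(2^j) u^(2^j)].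
Going down from [C = c^(2^s)], each step chooses a square root [b] of the previous
coefficient; by the parallelogram identity, one of the two roots at least doubles
[Q]. *)
Lemma geometric_doubling Q y s : invariant_form Q -> forall w C, cbounded w -> 0 <= Q w ->
  exists c w', [/\ cbounded w', 2 ^+ s * Q w <= Q w' &
    forall x, w' x - cval c * w' (x + y) = w x - cval C * w (x + y *+ 2 ^ s)].
Proof.
move=> [QP Qs Qr]; elim: s => [|s IH] w C bw Qw.
  by exists C, w; split=> //; rewrite mul1r.
have [b b2] := circle_divisible C (isT : (0 < 2)%N).
pose u x := cval b * w (x + y *+ 2 ^ s).
have bu : cbounded u by apply: cboundedZ; exact: cbounded_shift.
have Qu : Q u = Q w by rewrite Qr ?Qs //; exact: cbounded_shift.
have [p [p2 pE]] := @circle_minus1 R.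
have bb (d : circle) : d *+ 2 = C -> 2 * Q w <= Q (fun x => w x + cval d * w (x + y *+ 2 ^ s)) ->
    exists c w', [/\ cbounded w', 2 ^+ s.+1 * Q w <= Q w' &
    forall x, w' x - cval c * w' (x + y) = w x - cval C * w (x + y *+ 2 ^ s.+1)].
  move=> dC; set w1 := fun x => _ => Qw1.
  have bw1 : cbounded w1 by apply: cboundedD => //; apply: cboundedZ; exact: cbounded_shift.
  have [|c [w' [bw' Qw' w'E]]] := IH w1 d bw1; first by apply: le_trans Qw1; rewrite mulr_ge0.
  exists c, w'; split=> // [|x].
    by apply: le_trans Qw'; rewrite exprSr -mulrA ler_wpM2l // exprn_ge0.
  have ss : x + y *+ 2 ^ s + y *+ 2 ^ s = x + y *+ 2 ^ s.+1.
    by rewrite -addrA -mulrnDr addnn -mul2n -expnS.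
  by rewrite w'E /w1 ss -dC cvalMn; ring.
have := QP w u bw bu; rewrite Qu => QPwu.
have [le|lt] := lerP (2 * Q w) (Q (fun x => w x + u x)).
  exact: (bb b b2).
apply: (bb (b + p)); first by rewrite mulrnDl b2 p2 addr0.
have -> : (fun x => w x + cval (b + p) * w (x + y *+ 2 ^ s)) = fun x => w x - u x.
  by apply/funext => x; rewrite cvalD pE /u; ring.
move: QPwu lt; lra.
Qed.

(** For the geometric sum [w'], [Q w'] grows like [2 ^ s] while [w' - c u w']
telescopes to the difference of two translates of [w] and stays bounded. *)
Lemma approximate_eigenvalue Q y w (eta : R) : invariant_form Q -> cbounded w -> 0 < Q w ->
  exists c w', cbounded w' /\
    0 < Q w' - eta * nrm2 m (fun x => w' (x + y) - cval c * w' x).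
Proof.
move=> Qinv bw Qw.
have [s hs] : exists s, 4 * `|eta| * nrm2 m w < 2 ^+ s * Q w.
  exists (Num.truncn (4 * `|eta| * nrm2 m w / Q w)); rewrite -ltr_pdivrMr //.
  apply: lt_le_trans (truncnS_gt _) _.
  by rewrite -natrX ler_nat ltn_expl.
have [c [w' [bw' Qw' w'E]]] := geometric_doubling y s Qinv 0 bw (ltW Qw).
exists (- c), w'; split=> //.
have -> : nrm2 m (fun x => w' (x + y) - cval (- c) * w' x) =
    nrm2 m (fun x => w x - cval 0 * w (x + y *+ 2 ^ s)).
  congr m; apply/funext => x; rewrite -w'E -(normsq_rotate c) mulrBr mulrA -cvalD subrr.
  by rewrite cval0 mul1r -[in LHS]normsqN opprB.
have le4 : nrm2 m (fun x => w x - cval 0 * w (x + y *+ 2 ^ s)) <= 4 * nrm2 m w.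
  apply: le_trans (nrm2B_le mP bw (cboundedZ _ (cbounded_shift _ bw))) _.
  rewrite nrm2_rotate ?nrm2_shift //; [lra|exact: cbounded_shift].
have ge0 : 0 <= nrm2 m (fun x => w x - cval 0 * w (x + y *+ 2 ^ s)).
  by apply: (nrm2_ge0 mP); apply: cboundedB => //; apply: cboundedZ; exact: cbounded_shift.
rewrite subr_gt0; apply: le_lt_trans (lt_le_trans hs Qw').
apply: le_trans (ler_wpM2r ge0 (ler_norm eta)) _.
by rewrite [4 * _]mulrC -mulrA ler_wpM2l.
Qed.

(** Subtracting from [Q] the defect of an eigenvalue already found leaves an invariant
form, still positive somewhere, to which the next translation is applied. *)
Lemma joint_approximate_eigenvalues Q (Y : seq N) w (eta : R) : uniq Y -> 0 <= eta ->
  invariant_form Q -> cbounded w -> 0 < Q w ->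
  exists (z : N -> circle) w', [/\ cbounded w', 0 < Q w' & forall y, y \in Y ->
    eta * nrm2 m (fun x => w' (x + y) - cval (z y) * w' x) < Q w'].
Proof.
move=> + eta0; elim: Y Q w => [|y Y IH] Q w /=; first by exists (fun=> 0), w; split.
move=> /andP[yY uY] Qinv bw Qw.
have [c [w1 [bw1 Qw1]]] := approximate_eigenvalue y eta Qinv bw Qw.
pose L v := fun x : N => v (x + y) - cval c * v x.
have Lb v : cbounded v -> cbounded (L v).
  by move=> bv; apply: cboundedB; [exact: cbounded_shift|exact: cboundedZ].
have Linv : invariant_form (fun v => Q v - eta * nrm2 m (L v)).
  apply: invariant_formB => //.
  apply: (invariant_form_comp invariant_form_nrm2) => // [v v' _ _|v v' _ _|v y' _|v d _].
  - by apply/funext => x; rewrite /L; ring.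
  - by apply/funext => x; rewrite /L; ring.
  - by apply/funext => x; rewrite /L addrAC.
  - by apply/funext => x; rewrite /L; ring.
have [z [w' [bw' Qw' zw']]] := IH _ w1 uY Linv bw1 Qw1.
have le v : cbounded v -> 0 <= eta * nrm2 m (L v).
  by move=> bv; rewrite mulr_ge0 // nrm2_ge0 //; exact: Lb.
exists (fun x => if x == y then c else z x), w'; split=> //.
  by apply: lt_le_trans Qw' _; rewrite gerBl le.
move=> x; rewrite inE; case: eqVneq => [-> _|_ /= /zw' h].
  by rewrite -subr_gt0.
by apply: lt_le_trans h _; rewrite gerBl le.
Qed.

End joint_eigenvectors.

(** * Continuous characters of a compact group separate points *)

Section compact_groups.
Context {R : realType} {N : topologicalZmodType}.
Hypotheses (hausN : hausdorff_space N) (compN : compact [set: N]).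

(** Finitely many translates of a neighbourhood of [0] cover a compact group, so a
finite sum of translates of [f] is bounded below by [d]. *)
Lemma mean_positive (m : (N -> R) -> R) (f : N -> R) (d : R) : invariant_mean m ->
  bounded_map f -> (forall x, 0 <= f x) -> 0 < d -> (\forall x \near (0 : N), d <= f x) ->
  0 < m f.
Proof.
move=> mP bf f0 d0 nd; have : nbhs (0 : N) [set x | d <= f x] by exact: nd.
rewrite nbhsE => -[O [oO O0] Od].
have [y|x [_ Cx]|s sC] := @compact_closed_family N N (fun y => ~` ((fun x => x + y) @^-1` O))
    [set: N] set0 compN _ open0.
- by apply: open_closedC; apply: open_comp => // x _; exact: shift_continuous.
- by apply: (Cx (- x) I); rewrite /= subrr.
have sf x : d <= \sum_(y <- s) f (x + y).
  have nx : ~ foldr (fun y A => ~` ((fun x => x + y) @^-1` O) `&` A) setT s x.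
    by move=> sx; suff : (set0 : set N) x by []; exact: sC.
  elim: (s) nx => [[]//|y t IH /= nx]; rewrite big_cons.
  have [Oxy|nOxy] := pselect (O (x + y)).
    by rewrite -[d]addr0 lerD ?sumr_ge0 //; exact: Od.
  by rewrite -[d]add0r lerD //; apply: IH => tx; apply: nx.
have bfy y : bounded_map (fun x => f (x + y)) by exact: (bounded_map_comp (fun x => x + y) bf).
have ms : m (fun x => \sum_(y <- s) f (x + y)) = m f *+ size s.
  rewrite (mean_sum mP) //; under eq_bigr do rewrite (mean_shift mP) //.
  by rewrite big_const_seq count_predT iter_addr addr0.
have := mean_le mP (bounded_map_cst d) (bounded_map_sum s bfy) sf; rewrite (mean_cst mP) ms => dm.
have mf0 := mean_ge0 mP bf f0.
rewrite lt_neqAle mf0 andbT; apply/eqP => mf; move: dm; rewrite -mf mul0rn; lra.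
Qed.

Lemma uniformly_continuous (h : N -> R) (e : R) : continuous h -> 0 < e ->
  \forall y \near (0 : N), forall x, `|h (x + y) - h x| < e.
Proof.
move=> ch e0; have := compN; rewrite compact_near_coveringP => ncN.
have key x : [set: N] x -> \forall x' \near x & y \near (0 : N), `|h (x' + y) - h x'| < e.
  move=> _; have c1 : h z.1 @[z --> (x, (0 : N))] --> h x.
    by apply: continuous_comp; [exact: cvg_fst|exact: ch].
  have c2 : h (z.1 + z.2) @[z --> (x, (0 : N))] --> h (x + 0).
    apply: (cvg_comp (fun z : N * N => z.1 + z.2) h); last exact: ch.
    exact: (@add_continuous N (x, 0)).
  rewrite addr0 in c2.
  have c3 : h (z.1 + z.2) - h z.1 @[z --> (x, (0 : N))] --> h x - h x by exact: cvgB.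
  rewrite subrr in c3.
  have c4 : \forall z \near (x, (0 : N)), `|0 - (h (z.1 + z.2) - h z.1)| < e.
    exact: (cvgr_dist_lt _ _ c3 _ e0).
  by apply: filterS c4 => -[x' y] /=; rewrite sub0r normrN.
have V := ncN N (nbhs (0 : N)) (fun y x => `|h (x + y) - h x| < e) (nbhs_filter _) key.
by apply: filterS V => y Vy x; exact: Vy.
Qed.

Lemma urysohn_function (W : set N) : nbhs (0 : N) W ->
  exists h : N -> R, [/\ continuous h, forall x, 0 <= h x <= 1, h 0 = 1 &
    forall x, h x <> 0 -> W x].
Proof.
rewrite nbhsE => -[O [oO O0] OW].
have /normal_separatorP sep := compact_normal hausN compN.
have [||| h [ch h01 hO h0]] := (uniform_separatorP (R := R) _ _).1 (sep R (~` O) [set 0] _ _ _).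
- exact: open_closedC.
- by apply: accessible_closed_set1; exact: hausdorff_accessible.
- by apply/seteqP; split=> // x [nO x0]; apply: nO; rewrite x0.
exists h; split=> // [x||x].
- by have := h01 (h x) (imageP h I); rewrite /= in_itv.
- by apply: h0; exists 0.
- move=> hx; apply: OW; apply: contrapT => nO; apply: hx.
  by apply: hO; exists x.
Qed.

(** For a homomorphism, continuity at [0] is continuity everywhere. *)
Definition continuous_character : set (N -> circle (R := R)) :=
  [set chi | (forall x y, chi (x - y) = chi x - chi y) /\
    forall e, 0 < e -> \forall x \near (0 : N), 1 - re (chi x) < e].

End compact_groups.

Section peter_weyl.
Context {R : realType} {N : topologicalZmodType}.
Hypotheses (hausN : hausdorff_space N) (compN : compact [set: N]).

(** The bump function [h] has a support disjoint from its translate by [a].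
Convolution by [k] is the composite of convolution by [h] and of the difference
between the identity and the translation by [a]; it does not annihilate the
reflection of [h], because at [0] the convolution is the mean of [h ^+ 2]. *)
Let smoothing (m : (N -> R) -> R) (a : N) : invariant_mean m -> a <> 0 ->
  exists (k h : N -> R) (c : R) v0, [/\ 
    forall x, k x = h x - h (x + a), forall x, `|h x| <= 1,
    forall e, 0 < e -> \forall y \near (0 : N), forall x, `|k (x + y) - k x| < e,
    0 < c & cbounded v0 /\ c * nrm2 m v0 < nrm2 m (conv m k v0)].
Proof.
move=> mP /eqP a0.
have := hausN; rewrite open_hausdorff.
move=> /(_ _ _ a0)[[B A]/= [/set_mem Ba /set_mem A0] [oB oA /eqP AB]].
have nW : nbhs (0 : N) (A `&` (fun y => y + a) @^-1` B).
  apply: filterI; first exact: open_nbhs_nbhs.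
  by apply: (@shift_continuous N a 0); rewrite add0r; exact: open_nbhs_nbhs.
have [h [ch h01 h0 hW]] := urysohn_function (R := R) hausN compN nW.
have hha x : h x * h (x + a) = 0.
  have [->|/eqP/hW[_ /= Bx]] := eqVneq (h x) 0; first by rewrite mul0r.
  have [->|/eqP/hW[Ax _]] := eqVneq (h (x + a)) 0; first by rewrite mulr0.
  by suff : set0 (x + a) by []; rewrite -AB.
have hab x : `|h x| <= 1 by have /andP[? ?] := h01 x; rewrite ger0_norm.
pose k x := h x - h (x + a).
have kab x : `|k x| <= 1.
  by have /andP[? ?] := h01 x; have /andP[? ?] := h01 (x + a); rewrite ler_norml /k; lra.
have kunif e : 0 < e -> \forall y \near (0 : N), forall x, `|k (x + y) - k x| < e.
  move=> e0; have e2 : 0 < e / 2 by rewrite divr_gt0.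
  apply: filterS (uniformly_continuous compN ch e2) => y hy x.
  have := hy x; have := hy (x + a); rewrite [x + a + y]addrAC /k => h1 h2.
  rewrite (_ : _ - _ = (h (x + y) - h x) - (h (x + y + a) - h (x + a))); last by ring.
  by apply: le_lt_trans (ler_normB _ _) _; lra.
pose v0 t : R[i] := Complex (h (- t)) 0.
have bh : bounded_map h by exists 1.
have bk : bounded_map k by exists 1.
have bhN : bounded_map (fun t => h (- t)) by exact: (bounded_map_comp -%R bh).
have bv0 : cbounded v0 by split=> //; exact: bounded_map_cst.
have bkx x : bounded_map (fun t => k (x - t)) by exact: (bounded_map_comp (fun t => x - t) bk).
pose g x := Re (conv m k v0 x).
have g0 : 0 < g 0.
  rewrite /g /=; apply: (mean_positive compN (d := 1 / 4)) => //.
  - exact: bounded_mapM.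
  - move=> t; rewrite /k sub0r mulrBl [h (- t + a) * _]mulrC hha subr0; nra.
  - by rewrite divr_gt0.
  - have half0 : 0 < 1 / 2 :> R by lra.
    apply: filterS (uniformly_continuous compN ch half0) => t /(_ (- t)).
    rewrite addNr h0 /k sub0r mulrBl [h (- t + a) * _]mulrC hha subr0 ltr_norml => /andP[? ?].
    nra.
have A0' : 0 < nrm2 m (conv m k v0).
  apply: (mean_positive compN (d := (g 0 / 2) ^+ 2)) => //.
  - exact/bounded_normsq/cbounded_conv.
  - by move=> x; exact: normsq_ge0.
  - by rewrite exprn_gt0 // divr_gt0.
  - have g2 : 0 < g 0 / 2 by rewrite divr_gt0.
    apply: filterS (kunif _ g2) => x kx.
    have gx : g 0 / 2 <= g x.
      have : m (fun t => (k (0 - t) - k (x - t)) * h (- t)) <= g 0 / 2.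
        rewrite -[leRHS](mean_cst mP); apply: (mean_le mP) => [||t].
        + by apply: bounded_mapM => //; exact: bounded_mapB.
        + exact: bounded_map_cst.
        + have := kx (0 - t); rewrite add0r [- t + x]addrC ltr_norml => /andP[? ?].
          have /andP[? ?] := h01 (- t); nra.
      have -> : (fun t => (k (0 - t) - k (x - t)) * h (- t)) =
          fun t => k (0 - t) * h (- t) - k (x - t) * h (- t).
        by apply/funext => t; rewrite mulrBl.
      rewrite (meanB mP); [|exact: bounded_mapM|exact: bounded_mapM].
      rewrite -[X in X - _]/(g 0) -[X in _ - X]/(g x); lra.
    rewrite /normsq -/(g x); apply: (@le_trans _ _ (g x ^+ 2)); last by rewrite lerDl sqr_ge0.
    by rewrite lerXn2r ?nnegrE ?(ltW g2) // (le_trans (ltW g2)).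
have B0 := nrm2_ge0 mP bv0.
exists k, h, (nrm2 m (conv m k v0) / (nrm2 m v0 + 1)), v0; split=> //.
  by rewrite divr_gt0 // ltr_wpDl.
split=> //; rewrite mulrAC ltr_pdivrMr ?ltr_wpDl //; nra.
Qed.

(** Let [S] be the convolution by the kernel [k] of [smoothing] and consider the
invariant form [nrm2 (S w) - c * nrm2 w], positive at [v0].  For each finite set of
translations it provides common approximate eigenvectors [w] with
[c * nrm2 w < nrm2 (S w)]; let [chi] be an ultralimit of the eigenvalues.  It is a
homomorphism since the translation by [x + y] is the composite of those by [x] and
[y].  If [chi a] were trivial, [w] would be almost fixed by the translation by [a],
and [S w], the convolution by [h] of the difference, almost zero.  For [y] close to
[0], translation by [y] hardly changes [S w], while it multiplies it by [chi y] up
to a small error; so [chi y] is close to [1]. *)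
Theorem continuous_characters_separate (a : N) : a <> 0 ->
  exists2 chi : N -> circle (R := R), continuous_character chi & chi a <> 0.
Proof.
move=> a0; have [m mP] := invariant_mean_exists R N.
have [k [h [c [v0 [kE h1 kunif c0 [bv0 cv0]]]]]] := smoothing mP a0.
have bh : bounded_map h by exists 1.
have bk : bounded_map k.
  by exists 2 => x; rewrite kE; apply: le_trans (ler_normB _ _) _; apply: (lerD (h1 _) (h1 _)).
have k2 x : `|k x| <= 2.
  by rewrite kE; apply: le_trans (ler_normB _ _) _; apply: (lerD (h1 _) (h1 _)).
have Sle v : cbounded v -> nrm2 m (conv m k v) <= 4 * nrm2 m v.
  by move=> bv; apply: le_trans (nrm2_conv_le mP bv k2) _; rewrite -natrX.
have bS (v : N -> R[i]) : cbounded v -> cbounded (conv m k v) by exact: cbounded_conv.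
have bsh (v : N -> R[i]) y : cbounded v -> cbounded (fun x => v (x + y)) by exact: cbounded_shift.
have brot (v : N -> R[i]) s : cbounded v -> cbounded (fun x => cval s * v x) by exact: cboundedZ.
have bdif (v : N -> R[i]) s y : cbounded v -> cbounded (fun x => v (x + y) - cval s * v x).
  by move=> bv; apply: cboundedB; [exact: bsh|exact: brot].
pose Q v := nrm2 m (conv m k v) - c * nrm2 m v.
have Qinv : invariant_form Q.
  apply: invariant_formB; last exact: invariant_form_nrm2.
  apply: (invariant_form_comp (invariant_form_nrm2 mP)) => //.
  - by move=> v w bv bw; exact: convD.
  - by move=> v w bv bw; exact: convB.
  - by move=> v y bv; exact: conv_shift.
  - by move=> v s bv; exact: convZ.
have Q0 : 0 < Q v0 by rewrite subr_gt0.
have [z zP] : exists z : seq N -> nat -> N -> circle (R := R), forall Y n, exists w,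
    [/\ cbounded w, 0 < Q w & forall y, y \in Y ->
      n.+1%:R * nrm2 m (fun x => w (x + y) - cval (z Y n y) * w x) <= nrm2 m w].
  suff /choice[z zP] : forall p : seq N * nat, exists z : N -> circle (R := R), exists w,
      [/\ cbounded w, 0 < Q w & forall y, y \in p.1 ->
        p.2.+1%:R * nrm2 m (fun x => w (x + y) - cval (z y) * w x) <= nrm2 m w].
    by exists (fun Y n => z (Y, n)) => Y n; exact: (zP (Y, n)).
  move=> [Y n] /=.
  have [|z [w [bw Qw zw]]] := joint_approximate_eigenvalues mP (undup_uniq Y)
    (_ : 0 <= 4 * n.+1%:R) Qinv bv0 Q0; first by rewrite mulr_ge0.
  exists z, w; split=> // y yY; rewrite -(ler_pM2l (_ : 0 < 4)) // mulrA.
  apply: le_trans (ltW (zw y _)) _; first by rewrite mem_undup.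
  apply: (le_trans _ (Sle _ bw)); rewrite gerBl mulr_ge0 ?(ltW c0) //; exact: nrm2_ge0.
have [chi chiP] := circle_ultralimit z.
have approx (Y : seq N) (e : R) : 0 < e -> exists w,
    [/\ cbounded w, c * nrm2 m w < nrm2 m (conv m k w), 0 < nrm2 m w &
      forall y, y \in Y -> nrm2 m (fun x => w (x + y) - cval (chi y) * w x) <= e * nrm2 m w].
  move=> e0; have e8 : 0 < e / 8 by rewrite divr_gt0.
  have [Y' [n [YY' en zchi]]] := chiP Y (Num.truncn (4 / e)) _ e8.
  have [w [bw Qw zw]] := zP Y' n.
  have w0 : 0 < nrm2 m w.
    have := Sle _ bw; have := nrm2_ge0 mP bw; rewrite /Q in Qw => ? ?; nra.
  exists w; split=> //; first by rewrite -subr_gt0.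
  move=> y yY; have -> : (fun x => w (x + y) - cval (chi y) * w x) =
      fun x => (w (x + y) - cval (z Y' n y) * w x) + (cval (z Y' n y) - cval (chi y)) * w x.
    by apply/funext => x; ring.
  have bz := cboundedZ (cval (z Y' n y) - cval (chi y)) bw.
  apply: le_trans (nrm2D_le mP (bdif w (z Y' n y) y bw) bz) _.
  rewrite (nrm2Z mP) // normsq_circle_sub.
  have := zw y (YY' _ yY); have := zchi y yY.
  set A := nrm2 m (fun x => _); set B := 1 - _ => Be An.
  have ne : 4 / e < n.+1%:R.
    by apply: lt_le_trans (truncnS_gt _) _; rewrite ler_nat ltnS.
  have A0 : 0 <= A by apply: nrm2_ge0 => //; exact: bdif.
  have Ae : 4 / e * A <= nrm2 m w by apply: le_trans An; rewrite ler_wpM2r // ltW.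
  have {}Ae : 4 * A <= e * nrm2 m w.
    rewrite (_ : 4 * A = e * (4 / e * A)); first by rewrite ler_wpM2l // ltW.
    by field; rewrite gt_eqF.
  nra.
have small (t : R) (C : R) : 0 <= C -> (forall e, 0 < e -> t <= C * e) -> t <= 0.
  move=> C0 tC; rewrite leNgt; apply/negP => t0.
  have := tC (t / (2 * (C + 1))); rewrite divr_gt0 ?mulr_gt0 ?ltr_wpDl // => /(_ isT).
  rewrite mulrA ler_pdivlMr ?mulr_gt0 ?ltr_wpDl //; nra.
have chiD x y : chi (x + y) = chi x + chi y.
  apply/eqP; rewrite -subr_eq0; apply/eqP/re_eq1/eqP; rewrite eq_le re_le1 /= -subr_le0.
  apply: (small _ 5) => // e e0.
  have [w [bw _ w0 wchi]] := approx [:: x; y; x + y] _ e0.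
  pose D y' t := w (t + y') - cval (chi y') * w t.
  have De y' : y' \in [:: x; y; x + y] -> nrm2 m (D y') <= e * nrm2 m w by exact: wchi.
  have bD y' : cbounded (D y') by exact: bdif.
  rewrite -(ler_pM2r w0) -(ler_pM2l (_ : 0 < 2)) // mulrA -normsq_circle_sub -(nrm2Z mP) //.
  have -> : (fun t => (cval (chi (x + y)) - cval (chi x + chi y)) * w t) =
      fun t => (D x (t + y) + cval (chi x) * D y t) - D (x + y) t.
    apply/funext => t; rewrite cvalD /D (_ : t + y + x = t + (x + y)); last first.
      by rewrite -addrA [y + x]addrC.
    by ring.
  apply: le_trans (nrm2B_le mP _ _) _ => //; first by apply: cboundedD; [exact: bsh|exact: brot].
  have := nrm2D_le mP (bsh _ y (bD x)) (brot _ (chi x) (bD y)).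
  rewrite (nrm2_shift mP) // (nrm2_rotate mP) //.
  have Dx := De x (mem_head _ _); have Dy : nrm2 m (D y) <= e * nrm2 m w.
    by apply: De; rewrite !inE eqxx orbT.
  have Dxy : nrm2 m (D (x + y)) <= e * nrm2 m w by apply: De; rewrite !inE eqxx !orbT.
  move=> Dxy'; lra.
exists chi; last first.
  move=> chia; suff : c <= 0 by rewrite leNgt c0.
  apply: (small _ 1) => // e e0; rewrite mul1r.
  have [w [bw cw w0 /(_ a (mem_head _ _))]] := approx [:: a] _ e0.
  have -> : (fun x => w (x + a) - cval (chi a) * w x) = fun x => w (x + a) - w x.
    by apply/funext => x; rewrite chia cval0 mul1r.
  move=> wa; rewrite -(ler_pM2r w0); apply: le_trans (ltW cw) _; apply: le_trans wa.
  have -> : nrm2 m (fun x => w (x + a) - w x) = nrm2 m (fun x => w x - w (x + a)).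
    by congr m; apply/funext => x; rewrite -normsqN opprB.
  have bwa : cbounded (fun x => w x - w (x + a)) by apply: cboundedB => //; exact: bsh.
  suff -> : conv m k w = conv m h (fun x => w x - w (x + a)).
    by apply: le_trans (nrm2_conv_le mP bwa h1) _; rewrite expr1n mul1r.
  rewrite (convB mP) ?(conv_shift mP) //; last exact: bsh.
  have -> : k = fun x => h x - h (x + a) by apply/funext.
  rewrite (conv_kernelB mP) //; last exact: (bounded_map_comp (fun x => x + a) bh).
  by rewrite conv_kernel_shift.
split=> [x y|e e0]; first by apply/eqP; rewrite eq_sym subr_eq -chiD subrK.
have d0 : 0 < Num.min 1 (c * e / 2) by rewrite lt_min ltr01 divr_gt0 // mulr_gt0.
apply: filterS (kunif _ d0) => y; set d := Num.min 1 _ => ky.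
have dce : d ^+ 2 <= c * e / 2.
  rewrite expr2; apply: le_trans (_ : 1 * (c * e / 2) <= _); last by rewrite mul1r.
  by apply: ler_pM; rewrite ?(ltW d0) // ge_min lexx ?orbT.
suff : c * (1 - re (chi y)) - d ^+ 2 <= 0.
  rewrite subr_le0 => le; rewrite -(ltr_pM2l c0); apply: le_lt_trans le _.
  by apply: le_lt_trans dce _; rewrite ltr_pdivrMr // ltr_pMr ?mulr_gt0 // ltr1n.
apply: (small _ 4) => // e' e'0.
have [w [bw cw w0 /(_ y (mem_head _ _)) wy]] := approx [:: y] _ e'0.
rewrite -(ler_pM2r w0) -(ler_pM2l (_ : 0 < 2)) //.
pose S := conv m k w; have bSw := bS _ bw.
have S1 : nrm2 m (fun x => S (x + y) - cval (chi y) * S x) <= 4 * (e' * nrm2 m w).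
  have -> : (fun x => S (x + y) - cval (chi y) * S x) =
      conv m k (fun x => w (x + y) - cval (chi y) * w x).
    by rewrite (convB mP) ?(conv_shift mP) ?(convZ mP) //; [exact: bsh|exact: brot].
  by apply: le_trans (Sle _ (bdif _ _ _ bw)) _; rewrite ler_pM2l.
have S2 : nrm2 m (fun x => S (x + y) - S x) <= d ^+ 2 * nrm2 m w.
  have -> : (fun x => S (x + y) - S x) = conv m (fun x => k (x + y) - k x) w.
    rewrite (conv_kernelB mP) //; last exact: (bounded_map_comp (fun x => x + y) bk).
    by rewrite conv_kernel_shift.
  by apply: nrm2_conv_le => // x; exact/ltW/ky.
have S3 : nrm2 m (fun x => (cval (chi y) - 1) * S x) <=
    2 * (d ^+ 2 * nrm2 m w) + 2 * (4 * (e' * nrm2 m w)).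
  have -> : (fun x => (cval (chi y) - 1) * S x) =
      fun x => (S (x + y) - S x) - (S (x + y) - cval (chi y) * S x).
    by apply/funext => x; ring.
  apply: le_trans (nrm2B_le mP _ _) _; [by apply: cboundedB => //; exact: bsh|exact: bdif|].
  by apply: lerD; rewrite ler_pM2l.
rewrite (nrm2Z mP) // in S3.
have e1 : normsq (cval (chi y) - 1) = 2 * (1 - re (chi y)).
  by rewrite -(@cval0 R) normsq_circle_sub subr0.
rewrite e1 in S3.
have r1 : 0 <= 1 - re (chi y) by rewrite subr_ge0 re_le1.
have := ler_wpM2l r1 (ltW cw); rewrite -/S => h'.
lra.
Qed.

End peter_weyl.

(** * Homomorphisms on a group of characters are evaluations *)

Section kronecker.
Context {R : realType} {N : topologicalZmodType}.
Hypotheses (compN : compact [set: N]).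
Implicit Types x y z : N -> circle (R := R).

Lemma continuous_character0 : continuous_character (0 : N -> circle (R := R)).
Proof.
split=> [x y|e e0]; first by rewrite subrr.
by apply: nearW => x; rewrite re0 subrr.
Qed.

Lemma continuous_character_val0 x : continuous_character x -> x 0 = 0.
Proof. by move=> [xB _]; rewrite -(subrr 0) xB subrr. Qed.

Lemma continuous_characterD x (a b : N) : continuous_character x -> x (a + b) = x a + x b.
Proof. by move=> [xB _]; apply/eqP; rewrite -subr_eq -xB addrK. Qed.

Lemma continuous_characterB x y : continuous_character x -> continuous_character y ->
  continuous_character (x - y).
Proof.
move=> [xB xc] [yB yc]; split=> [a b|e e0].
  rewrite -[LHS]/(x _ - y _) xB yB !opprB -!addrA; congr (_ + _).
  by rewrite addrCA addrC -!addrA addrC addrA.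
have e4 : 0 < e / 4 by rewrite divr_gt0.
apply: filterS (filterI (xc _ e4) (yc _ e4)) => a [/= xa ya].
have := re_dist_triangle (x a) (- y a); rewrite reN -[x a - y a]/((x - y) a); lra.
Qed.

Lemma subgroup_continuous_character : subgroup (@continuous_character R N).
Proof. by apply: subgroupI; [exact: continuous_character0|exact: continuous_characterB]. Qed.

Lemma re_character_continuous x (t : circle) : continuous_character x ->
  continuous (fun n => re (x n - t)).
Proof.
move=> xc n; apply/cvgrPdist_lt => e e0.
have e2 : 0 < e ^+ 2 / 2 by rewrite divr_gt0 ?exprn_gt0.
have [_ /(_ _ e2)] := xc; move=> xe.
have : \forall a \near n, 1 - re (x (a - n)) < e ^+ 2 / 2.
  by apply: (@shift_continuous N (- n) n [set b | 1 - re (x b) < e ^+ 2 / 2]); rewrite /= subrr.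
move=> near_n; apply: filterS near_n => a xa.
have -> : x a - t = (x n - t) + x (a - n).
  by rewrite addrAC -continuous_characterD // [n + _]addrC subrK.
have := normsq_circle_sub (x n - t) ((x n - t) + x (a - n)).
have -> : x n - t - (x n - t + x (a - n)) = - x (a - n) by rewrite opprD addNKr.
rewrite reN /normsq raddfB /= -![Re (cval _)]/(re _) => h.
have : (re (x n - t) - re (x n - t + x (a - n))) ^+ 2 < e ^+ 2.
  by have := sqr_ge0 (Im (cval (x n - t) - cval (x n - t + x (a - n)))); lra.
by rewrite -(real_normK (num_real (_ - _))) ltr_pXn2r ?nnegrE ?normr_ge0 ?ltW.
Qed.

Section orthogonality.
Variables (m : (N -> R) -> R) (mP : invariant_mean m).

Lemma bounded_re (x : N -> circle (R := R)) : bounded_map (fun n => re (x n)).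
Proof.
exists 1 => n; rewrite ler_norml re_le1 andbT.
by have := normsq_circle (x n); rewrite /normsq /re; nra.
Qed.

(** Translating by [a] replaces [t] by [t - x a], so that the mean takes the same value
at [t], [t - x a] and [t + x a], whereas the sum of the last two is [2 * re (x a)]
times the first. *)
Lemma mean_character x t : continuous_character x -> x <> 0 -> m (fun n => re (x n - t)) = 0.
Proof.
move=> xc xn0; have [a xa] : exists a, x a <> 0.
  apply: contrapT => na; apply: xn0; apply/funext => a.
  by apply: contrapT => ?; apply: na; exists a.
have bre s : bounded_map (fun n => re (x n - s)) by exact: (bounded_re (fun n => x n - s)).
have sh s : m (fun n => re (x n - (s - x a))) = m (fun n => re (x n - s)).
  rewrite -(mean_shift mP a (bre s)); congr m; apply/funext => n.
  by rewrite continuous_characterD // opprB addrA.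
have := sh t; have := sh (t + x a); rewrite addrK => h1 h2.
have : m (fun n => re (x n - (t - x a)) + re (x n - (t + x a))) =
    2 * re (x a) * m (fun n => re (x n - t)).
  rewrite -(meanZ mP) //; congr m; apply/funext => n.
  by rewrite opprB opprD !addrA [x n + x a - t]addrAC reDB mulrAC.
rewrite (meanD mP) // h2 -h1.
have : re (x a) != 1 by apply/eqP => /re_eq1.
set r := re _; set M := m _ => r1 e; have /eqP : (1 - r) * M = 0 by lra.
by rewrite mulf_eq0 subr_eq0 eq_sym (negPf r1) => /eqP.
Qed.

Lemma normsq_sum (I : Type) (l : seq I) (s : I -> circle (R := R)) :
  normsq (\sum_(i <- l) cval (s i)) = \sum_(i <- l) \sum_(j <- l) re (s i - s j).
Proof.
have RR (z : R[i]) : normsq z = Re (z * conjc z).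
  by case: z => a b; rewrite /normsq /=; ring.
rewrite RR rmorph_sum mulr_suml raddf_sum; apply: eq_bigr => i _.
by rewrite mulr_sumr raddf_sum; apply: eq_bigr => j _.
Qed.

Variables (X : set (N -> circle (R := R))) (phi : (N -> circle (R := R)) -> circle (R := R)).
Hypotheses (subX : subgroup X) (contX : X `<=` @continuous_character R N).
Hypothesis phiB : forall x y, X x -> X y -> phi (x - y) = phi x - phi y.

Implicit Types l : seq (N -> circle (R := R)).

(** The character [x] rotated by the value that [phi] prescribes for it: [twist x n] is
[1] exactly when [x n = phi x]. *)
Definition twist x (n : N) : R[i] := cval (x n - phi x).

Definition twisted_sum l (n : N) : R[i] := \sum_(x <- l) twist x n.

Definition coincidences l l' : R := \sum_(x <- l) \sum_(y <- l') (x == y)%:R.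

Let phiD x y : X x -> X y -> phi (x + y) = phi x + phi y.
Proof.
move=> Xx Xy; apply/eqP; rewrite -subr_eq -phiB ?addrK //; exact: subgroupD.
Qed.

Lemma twistD x y n : X x -> X y -> twist (x + y) n = twist x n * twist y n.
Proof. by move=> Xx Xy; rewrite /twist phiD // -cvalD opprD addrACA. Qed.

Lemma normsq_twist x n : normsq (twist x n) = 1. Proof. exact: normsq_circle. Qed.

Lemma cbounded_twisted_sum l : cbounded (twisted_sum l).
Proof.
elim: l => [|x l IH]; rewrite /twisted_sum.
  by under eq_fun do rewrite big_nil; exact: cbounded_cst.
under eq_fun do rewrite big_cons; apply: cboundedD => //.
exact/cbounded_unit/normsq_twist.
Qed.

Lemma cbounded_defect x l : cbounded (fun n => (1 - twist x n) * twisted_sum l n).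
Proof.
apply: cboundedM; last exact: cbounded_twisted_sum.
apply: cboundedB; first exact: cbounded_cst.
exact/cbounded_unit/normsq_twist.
Qed.

(** Distinct characters are orthogonal, and equal ones are rotated equally. *)
Lemma nrm2_twisted_sum l : {in l, forall x, X x} ->
  nrm2 m (twisted_sum l) = coincidences l l.
Proof.
move=> lX; rewrite /nrm2 /coincidences.
have bre x y : bounded_map (fun n => re (x n - phi x - (y n - phi y))).
  exact: (bounded_re (fun n => x n - phi x - (y n - phi y))).
under [X in m X]funext do rewrite normsq_sum.
rewrite (mean_sum mP) => [|x]; last exact: bounded_map_sum.
rewrite big_seq [RHS]big_seq; apply: eq_bigr => x xl; rewrite (mean_sum mP) //.
rewrite big_seq [RHS]big_seq; apply: eq_bigr => y yl.
have [<-|/eqP xy] := eqVneq x y.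
  by under [X in m X]funext do rewrite subrr re0; rewrite mean_cst.
have xy0 : x - y <> 0 by move=> /eqP; rewrite subr_eq0 => /eqP.
apply: etrans (mean_character (phi (x - y)) (contX (subgroupB subX (lX _ xl) (lX _ yl))) xy0).
congr m; apply/funext => n; rewrite (phiB (lX _ xl) (lX _ yl)) -[(x - y) n]/(x n - y n).
by congr re; rewrite !opprB addrACA [in RHS]addrACA; congr (_ + _); rewrite addrC.
Qed.

Lemma coincidences_ge0 l l' : 0 <= coincidences l l'.
Proof. by do 2 (apply: sumr_ge0 => ? _). Qed.

Lemma coincidences_cat l : forall l', coincidences l l + coincidences l' l' <=
  coincidences (l ++ l') (l ++ l').
Proof.
move=> l'; have e (r : seq (N -> circle (R := R))) :
    \sum_(x <- r) \sum_(y <- l ++ l') (x == y)%:R = coincidences r l + coincidences r l'.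
  by rewrite /coincidences -big_split; apply: eq_bigr => x _; rewrite big_cat.
rewrite [leRHS]/coincidences big_cat /= !e.
by have := coincidences_ge0 l l'; have := coincidences_ge0 l' l; lra.
Qed.

Lemma coincidences_translate z l :
  coincidences [seq x + z | x <- l] [seq x + z | x <- l] = coincidences l l.
Proof.
rewrite /coincidences big_map; apply: eq_bigr => x _; rewrite big_map.
by apply: eq_bigr => y _; rewrite (inj_eq (addIr z)).
Qed.

(** The sum for [l'] is the product of the sum for [l] and of the geometric sum of the
first [2 ^ s] powers of [twist y].  Each doubling of the list at least doubles the
number of coincidences, because the mixed terms are nonnegative. *)
Lemma twisted_sum_doubling s l y : {in l, forall x, X x} -> X y ->
  exists l', [/\ {in l', forall x, X x},
    2 ^+ s * coincidences l l <= coincidences l' l',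
    forall n, (1 - twist y n) * twisted_sum l' n = (1 - twist (y *+ 2 ^ s) n) * twisted_sum l n &
    forall x, nrm2 m (fun n => (1 - twist x n) * twisted_sum l' n) <=
      4 ^+ s * nrm2 m (fun n => (1 - twist x n) * twisted_sum l n)].
Proof.
move=> lX Xy; elim: s => [|s [l' [l'X cl' tw nl']]].
  by exists l; split=> // [|x]; rewrite mul1r.
pose z := y *+ 2 ^ s; have Xz : X z by exact: subgroupMn.
have sumE n : twisted_sum (l' ++ [seq x + z | x <- l']) n = (1 + twist z n) * twisted_sum l' n.
  rewrite /twisted_sum big_cat big_map mulrDl mul1r /=; congr (_ + _).
  rewrite mulr_sumr big_seq [RHS]big_seq; apply: eq_bigr => x xl.
  by rewrite twistD //; [exact: mulrC|exact: l'X].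
exists (l' ++ [seq x + z | x <- l']); split.
- move=> x; rewrite mem_cat => /orP[/l'X//|/mapP[x' /l'X Xx' ->]]; exact: subgroupD.
- apply: le_trans (coincidences_cat _ _); rewrite coincidences_translate exprS.
  by rewrite -mulrA mulr_natl mulr2n lerD.
- move=> n; rewrite sumE mulrCA tw mulrA; congr (_ * _).
  rewrite expnS mulnC mulrnA mulr2n twistD // -/z; ring.
- move=> x; rewrite exprS -mulrA.
  have bt := cbounded_defect x l'.
  have bz : cbounded (fun n => twist z n * ((1 - twist x n) * twisted_sum l' n)).
    by apply: cboundedM => //; exact/cbounded_unit/normsq_twist.
  have -> : (fun n => (1 - twist x n) * twisted_sum (l' ++ [seq x + z | x <- l']) n) =
      fun n => (1 - twist x n) * twisted_sum l' n +
        twist z n * ((1 - twist x n) * twisted_sum l' n).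
    by apply/funext => n; rewrite sumE; ring.
  apply: le_trans (nrm2D_le mP bt bz) _.
  have -> : nrm2 m (fun n => twist z n * ((1 - twist x n) * twisted_sum l' n)) =
      nrm2 m (fun n => (1 - twist x n) * twisted_sum l' n).
    by congr m; apply/funext => n; rewrite normsqM normsq_twist mul1r.
  have := nl' x; lra.
Qed.

(** The characters of [ys] are treated one after the other.  Handling [y] multiplies
the defects of the others by at most [4 ^ s], so these are made smaller by that
factor beforehand. *)
Lemma simultaneous_concentration (ys : seq (N -> circle (R := R))) (e : R) :
  0 < e -> {in ys, forall y, X y} -> exists l, [/\ 0 < nrm2 m (twisted_sum l) &
    {in ys, forall y, nrm2 m (fun n => (1 - twist y n) * twisted_sum l n) <=
      e * nrm2 m (twisted_sum l)}].
Proof.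
suff h : forall e, 0 < e -> {in ys, forall y, X y} -> exists l,
    [/\ {in l, forall x, X x}, 0 < coincidences l l &
    {in ys, forall y, nrm2 m (fun n => (1 - twist y n) * twisted_sum l n) <=
      e * coincidences l l}].
  move=> e0 ysX; have [l [lX l0 le]] := h _ e0 ysX.
  by exists l; rewrite nrm2_twisted_sum.
elim: ys {e} => [|y ys IH] e e0 ysX.
  exists [:: 0]; split=> // [x|]; first by rewrite inE => /eqP ->; exact: subgroup0.
  by rewrite /coincidences !big_cons !big_nil eqxx !addr0.
have Xy : X y by apply: ysX; exact: mem_head.
pose s := Num.truncn (4 / e).
have se : 4 / e <= 2 ^+ s.
  apply: le_trans (ltW (truncnS_gt _)) _; rewrite -natrX ler_nat; exact: ltn_expl.
have e'0 : 0 < e / 4 ^+ s by rewrite divr_gt0 // exprn_gt0.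
have [|l [lX l0 le]] := IH _ e'0; first by move=> x xys; apply: ysX; rewrite inE xys orbT.
have [l' [l'X cl' tw nl']] := twisted_sum_doubling s lX Xy.
have s1 : 1 <= 2 ^+ s :> R by rewrite -natrX ler1n expn_gt0.
have ll' : coincidences l l <= coincidences l' l'.
  by apply: le_trans cl'; rewrite -[leLHS]mul1r ler_wpM2r // ltW.
exists l'; split=> //; first exact: lt_le_trans ll'.
move=> x; rewrite inE => /predU1P[->|/le lex]; last first.
  apply: le_trans (nl' x) _; apply: le_trans (_ : e * coincidences l l <= _).
    by move: lex; rewrite mulrAC ler_pdivlMr ?exprn_gt0 // mulrC.
  by rewrite ler_wpM2l // ltW.
under [X in nrm2 m X]funext do rewrite tw.
apply: (@le_trans _ _ (4 * coincidences l l)).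
  have bl := cbounded_twisted_sum l.
  have btl : cbounded (fun n => twist (y *+ 2 ^ s) n * twisted_sum l n).
    by apply: cboundedM => //; exact/cbounded_unit/normsq_twist.
  have -> : (fun n => (1 - twist (y *+ 2 ^ s) n) * twisted_sum l n) =
      fun n => twisted_sum l n - twist (y *+ 2 ^ s) n * twisted_sum l n.
    by apply/funext => n; ring.
  apply: le_trans (nrm2B_le mP bl btl) _.
  have -> : nrm2 m (fun n => twist (y *+ 2 ^ s) n * twisted_sum l n) = nrm2 m (twisted_sum l).
    by congr m; apply/funext => n; rewrite normsqM normsq_twist mul1r.
  by rewrite nrm2_twisted_sum //; lra.
apply: le_trans (_ : e * (2 ^+ s * coincidences l l) <= _); last by rewrite ler_wpM2l // ltW.
rewrite mulrA ler_wpM2r ?(ltW l0) // -ler_pdivrMl // mulrC; exact: se.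
Qed.

End orthogonality.

(** By compactness it suffices to satisfy finitely many conditions approximately.  If
at every point one of them failed, then the defects of a concentrated sum [v] would
dominate [normsq v] pointwise, hence also in the mean. *)
Theorem kronecker (X : set (N -> circle (R := R)))
    (phi : (N -> circle (R := R)) -> circle (R := R)) :
  subgroup X -> X `<=` @continuous_character R N ->
  (forall x y, X x -> X y -> phi (x - y) = phi x - phi y) ->
  exists n, forall x, X x -> x n = phi x.
Proof.
move=> subX contX phiB.
pose C (p : X * nat) := [set n | 1 - p.2.+1%:R^-1 <= re (val p.1 n - phi (val p.1))].
have clC p : closed (C p).
  have := re_character_continuous (t := phi (val p.1)) (contX _ (set_valP p.1)).
  move=> /continuous_closedP/(_ [set r | 1 - p.2.+1%:R^-1 <= r]); apply; exact: closed_ge.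
have [n nC] : exists n, forall p, C p n.
  apply: contrapT => noC.
  have [x [_ Cx]|s sC] := @compact_closed_family N _ C [set: N] set0 compN clC open0.
    by apply: noC; exists x => p; exact: Cx.
  have [m mP] := invariant_mean_exists R N.
  pose ys := [seq val p.1 | p <- (s : seq (X * nat))].
  have ysX : {in ys, forall y, X y} by move=> _ /mapP[p _ ->]; exact: set_valP.
  pose E : R := \sum_(p <- s) p.2.+1%:R.
  have E0 : 0 < 1 / (E + 1) by rewrite divr_gt0 // ltr_wpDl // sumr_ge0.
  have [l [l0 ll]] := simultaneous_concentration mP subX contX phiB E0 ysX.
  pose v := twisted_sum phi l; have bv : cbounded v by exact: cbounded_twisted_sum.
  pose f (p : X * nat) n := p.2.+1%:R * normsq ((1 - twist phi (val p.1) n) * v n).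
  have bf p : bounded_map (f p).
    apply: bounded_mapM; first exact: bounded_map_cst.
    exact/bounded_normsq/cbounded_defect.
  pose r (p : X * nat) n := re (val p.1 n - phi (val p.1)).
  have fE p n : f p n = 2 * (p.2.+1%:R * (1 - r p n)) * normsq (v n).
    by rewrite /f normsqM /twist -(@cval0 R) normsq_circle_sub sub0r reN /r; ring.
  have vf n : normsq (v n) <= \sum_(p <- s) f p n.
    have nx : ~ foldr (fun p A => C p `&` A) setT s n.
      by move=> sn; suff : (set0 : set N) n by []; exact: sC.
    elim: (s) nx => [[]//|p t IHt /= nx]; rewrite big_cons.
    have f0 q : 0 <= f q n by rewrite /f mulr_ge0 // normsq_ge0.
    have [Cp|nCp] := pselect (C p n).
      by rewrite -[leLHS]add0r lerD //; apply: IHt => tn; apply: nx.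
    rewrite -[leLHS]addr0 lerD ?sumr_ge0 // fE.
    rewrite -[leLHS]mul1r ler_wpM2r ?normsq_ge0 //.
    have lt1 : r p n < 1 - p.2.+1%:R^-1 by rewrite ltNge; apply/negP.
    have : 1 < p.2.+1%:R * (1 - r p n).
      by rewrite -ltr_pdivrMl // mulr1 ltrBrDr addrC -ltrBrDr.
    lra.
  have := mean_le mP (bounded_normsq bv) (bounded_map_sum s bf) vf.
  rewrite (mean_sum mP) // leNgt => /negP; apply.
  apply: (@le_lt_trans _ _ (\sum_(p <- s) p.2.+1%:R * (1 / (E + 1) * nrm2 m v))).
    rewrite big_seq [leRHS]big_seq; apply: ler_sum => p ps.
    rewrite /f (meanZ mP) ?ler_pM2l //; last exact/bounded_normsq/cbounded_defect.
    by apply: ll; apply/mapP; exists p.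
  have E1 : E * (1 / (E + 1)) < 1.
    by rewrite mul1r ltr_pdivrMr ?mul1r ?ltrDl // ltr_wpDl // sumr_ge0.
  by rewrite -mulr_suml -/E mulrA -[ltRHS]mul1r ltr_pM2r.
exists n => x Xx; apply/eqP; rewrite -subr_eq0; apply/eqP/re_eq1/eqP.
rewrite eq_le re_le1 /= leNgt; apply/negP => lt1.
have := nC (SigSub (mem_set Xx), Num.truncn (1 - re (x n - phi x))^-1).
rewrite /C /= leNgt => /negP; apply; rewrite ltrBrDr addrC -ltrBrDr.
rewrite -[ltRHS]invrK ltf_pV2 ?posrE ?invr_gt0 ?subr_gt0 //; exact: truncnS_gt.
Qed.

End kronecker.

(** * Small compact subgroups *)

Lemma compact_set_type (X : topologicalType) (A : set X) : compact A -> compact [set: A].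
Proof.
move=> cA F FF _; have [|p [Ap clp]] := cA (val @ F) _.
  by apply: (@filterE _ F) => a; exact: set_valP.
exists (SigSub (mem_set Ap)); split=> // B C FB.
rewrite nbhsE => -[W [[W' oW' <-] W'p] WC].
have [||_ [[a Ba <-] W'a]] := clp (val @` B) W'.
- have FB' : F (val @^-1` (val @` B)) by apply: filterS FB => a Ba; exists a.
  exact: FB'.
- exact: open_nbhs_nbhs.
by exists a; split=> //; exact: WC.
Qed.

Section subgroup_type.
Context {K : topologicalZmodType} (N : set K) (subN : subgroup N).

Definition subgroup_type of subgroup N : Type := set_type N.
Local Notation H := (subgroup_type subN).

HB.instance Definition _ := Topological.copy H (set_type N).

Let inN (x : K) (Nx : N x) : H := SigSub (mem_set Nx).
Let Nval (a : H) : N (val a). Proof. exact: set_valP. Qed.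

Definition subgroup_add (a b : H) : H := inN (subgroupD subN (Nval a) (Nval b)).
Definition subgroup_opp (a : H) : H := inN (subgroupN subN (Nval a)).
Definition subgroup_zero : H := inN (subgroup0 subN).

Fact subgroup_addA : associative subgroup_add.
Proof. by move=> a b c; apply/val_inj; exact: addrA. Qed.
Fact subgroup_addC : commutative subgroup_add.
Proof. by move=> a b; apply/val_inj; exact: addrC. Qed.
Fact subgroup_add0 : left_id subgroup_zero subgroup_add.
Proof. by move=> a; apply/val_inj; exact: add0r. Qed.
Fact subgroup_addN : left_inverse subgroup_zero subgroup_opp subgroup_add.
Proof. by move=> a; apply/val_inj; exact: addNr. Qed.

HB.instance Definition _ :=
  GRing.isZmodule.Build H subgroup_addA subgroup_addC subgroup_add0 subgroup_addN.

Fact subgroup_sub_continuous : continuous (fun p : H * H => p.1 - p.2).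
Proof.
have cval : continuous (val : H -> K) by exact: (@initial_continuous N K val).
apply: (@continuous_comp_initial _ _ _ (val : H -> K)) => -[a b].
apply: (cvg_comp (fun p : H * H => (val p.1, val p.2)) (fun p : K * K => p.1 - p.2)).
  have c1 : val p.1 @[p --> (a, b)] --> val a.
    by apply: (cvg_comp (fst : H * H -> H) (val : H -> K)); [exact: cvg_fst|exact: cval].
  have c2 : val p.2 @[p --> (a, b)] --> val b.
    by apply: (cvg_comp (snd : H * H -> H) (val : H -> K)); [exact: cvg_snd|exact: cval].
  exact: cvg_pair c1 c2.
exact: (@sub_continuous K (val a, val b)).
Qed.

HB.instance Definition _ :=
  PreTopologicalNmodule_isTopologicalZmodule.Build H subgroup_sub_continuous.

End subgroup_type.

Section small_subgroups.
Context {K : topologicalZmodType}.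
Hypotheses (hausK : hausdorff_space K) (lcK : locally_compact [set: K]).

Lemma nbhs0_sub (U : set K) : nbhs (0 : K) U ->
  exists2 V, nbhs (0 : K) V & forall x y, V x -> V y -> U (x - y).
Proof.
move=> U0; have : nbhs ((0 : K) - 0) U by rewrite subrr.
move=> /(@sub_continuous K (0, 0))[[A B] [/= A0 B0] AB].
exists (A `&` B); first exact: filterI.
by move=> x y [Ax _] [_ By]; exact: (AB (x, y)).
Qed.

Lemma locally_compact_regular (U : set K) : nbhs (0 : K) U ->
  exists2 C, closed C /\ nbhs (0 : K) C & C `<=` U.
Proof.
have /(_ (0 : K) I)[W W0 [cW _]] := lcK.
rewrite /within /= in W0.
have nW : nbhs (0 : K) W by apply: filterS W0 => x /(_ I).
move=> /(compact_regular hausK cW nW)[A A0 AU].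
exists (closure A) => //; split; first exact: closed_closure.
by apply: filterS A0; exact: subset_closure.
Qed.

(** If [U n.+1 - U n.+1 `<=` U n] for all [n], then the intersection of the [U n] is a
subgroup. *)
Lemma small_compact_subgroup (V : set K) : nbhs (0 : K) V -> exists U : nat -> set K,
  [/\ forall n, closed (U n) /\ nbhs (0 : K) (U n), compact (U 0%N),
      subgroup (\bigcap_n U n) & \bigcap_n U n `<=` V].
Proof.
move=> V0; have /choice[f fP] (U : set K) : exists C, nbhs (0 : K) U ->
    [/\ closed C, nbhs (0 : K) C & forall x y, C x -> C y -> U (x - y)].
  have [U0|nU] := pselect (nbhs (0 : K) U); last by exists set0.
  have [A /locally_compact_regular[C [clC C0] CA] AU] := nbhs0_sub U0.
  by exists C => _; split=> // x y /CA Ax /CA; exact: AU.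
have /(_ (0 : K) I)[W W0 [cW clW]] := lcK.
rewrite /within /= in W0.
have nW : nbhs (0 : K) W by apply: filterS W0 => x /(_ I).
have f_sub U : nbhs (0 : K) U -> f U `<=` U.
  move=> U0 x fx; have [_ f0 fU] := fP _ U0.
  by rewrite -[x]subr0; apply: fU => //; exact: nbhs_singleton.
pose U n := iter n.+1 f (W `&` V).
have U0 n : nbhs (0 : K) (iter n f (W `&` V)).
  by elim: n => [|n IH] /=; [exact: filterI|have [] := fP _ IH].
exists U; split.
- by move=> n; have [] := fP _ (U0 n).
- have [clU _ _] := fP _ (U0 0%N); apply: subclosed_compact cW _ => //.
  by move=> x /(f_sub _ (U0 0%N))[].
- apply: subgroupI => [n _|x y Nx Ny n _]; first exact: (nbhs_singleton (U0 n.+1)).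
  by have [_ _] := fP _ (U0 n.+1); apply; [exact: (Nx n.+1 I)|exact: (Ny n.+1 I)].
- by move=> x /(_ 0%N I) /(f_sub _ (U0 0%N))[].
Qed.

End small_subgroups.

(** * Null families of subgroups in compact groups *)

(** A finitely supported map is determined by the finite list of its nonzero values,
each coded as a pair of an index and a natural number. *)
Lemma card_le_finite_support (Z : choiceType) (T : Type) (X : set Z) (D : set T) (t0 : T)
    (f : Z -> Z -> T) U (S : set U) :
  infinite_set S -> countable D ->
  (forall x, X x -> finite_set [set i | f x i <> t0]) ->
  (forall x i, X x -> D (f x i)) ->
  (forall x y, X x -> X y -> f x = f y -> x = y) ->
  [set i | exists2 x, X x & f x i <> t0] #<= S -> X #<= S.
Proof.
move=> Sinf Dc ffin fD finj; set J := [set i | _] => JS.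
have [c [_ cinj]] := card_le_fun 0%N Dc.
pose A := J `*` [set: nat].
have AS : A #<= S.
  by apply: card_le_trans (card_le_setX JS (card_lexx _)) (infinite_absorbs_nat Sinf).
apply: card_le_trans (card_le_seq Sinf AS).
pose graph x : set A := [set p | f x (val p).1 <> t0 /\ (val p).2 = c (f x (val p).1)].
have /choice[s sP] x : exists s : seq A, X x -> graph x = [set` s].
  have [Xx|nXx] := pselect (X x); last by exists [::].
  suff /finite_seqP[s sE] : finite_set (graph x) by exists s.
  apply: (@sub_finite_set _ _ (val @^-1` ((fun i => (i, c (f x i))) @` [set i | f x i <> t0]))).
    by move=> p [px pc]; exists (val p).1 => //; rewrite -pc; case: (val p).
  apply: finite_preimage; first by move=> ? ? _ _; exact: val_inj.
  exact/finite_image/ffin.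
apply: (card_le_inj (f := s)) => // x y Xx Xy sxy.
have gxy : graph x = graph y by rewrite sP // sxy -sP.
have sub u v : X u -> X v -> graph u = graph v -> forall i, f u i <> t0 -> f u i = f v i.
  move=> Xu Xv guv i ui.
  have Ai : A (i, c (f u i)) by split=> //=; exists u.
  have : graph u (SigSub (mem_set Ai)) by [].
  by rewrite guv => -[_ /= cuv]; apply: cinj => //; exact: fD.
apply: finj => //; apply/funext => i.
have [xi|xi] := pselect (f x i <> t0); first exact: sub.
have [yi|yi] := pselect (f y i <> t0); first by rewrite (sub y x).
by rewrite (contrapT xi) (contrapT yi).
Qed.

(** Embed the group [X] of continuous characters into finitely supported maps by [f].
The index [i] is in [J] when the [i]-th coordinate of [f] is not identically zero;
that coordinate is the evaluation at a nonzero point, which belongs to [M i].  The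
conditions defining a neighbourhood of [0] involve finitely many characters, and
[M i] satisfies them exactly as soon as [i] is outside their finite supports.  The
last clause bounds the number of neighbourhoods needed to isolate [0]. *)
Theorem compact_null_subgroups (R : realType) (N : topologicalZmodType) :
  hausdorff_space N -> compact [set: N] ->
  exists (I : Type) (J : set I) (M : I -> set N), [/\
    forall i, J i -> [/\ subgroup (M i), closed (M i) & exists2 n, M i n & n <> 0],
    forall U, nbhs (0 : N) U -> finite_set (J `&` [set i | ~ (M i `<=` U)]) &
    forall T (S : set T), infinite_set S -> J #<= S -> exists DD : set (set N),
      [/\ DD #<= S, forall D, DD D -> nbhs (0 : N) D & \bigcap_(D in DD) D `<=` [set 0]]].
Proof.
move=> hausN compN; pose X := @continuous_character R N.
have subX : subgroup X by exact: subgroup_continuous_character.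
pose Z := N -> circle (R := R).
have [f [fB ffin fD f0]] : exists f : Z -> Z -> circle (R := R),
    [/\ forall x y, X x -> X y -> f (x - y) = f x - f y,
        forall x, X x -> finite_set [set i | f x i <> 0],
        forall x i, X x -> circle_hull (f x i) &
        forall x, X x -> f x = 0 -> x = 0].
  apply: finite_support_embedding => //.
  - by apply: subgroupI; [exact: circle_hull0|exact: circle_hull_sub].
  - exact: circle_hull_root.
  - exact: circle_hull_torsion.
  - by exists circle_345; [exact: circle_hull_345|exact: circle_345_infinite_order].
pose J := [set i | exists2 x, X x & f x i <> 0].
pose M i := [set n : N | forall x, X x -> f x i = 0 -> x n = 0].
pose C (p : X * nat) : set N := [set n | 1 - p.2.+1%:R^-1 <= re (val p.1 n)].
have clre x (r : R) : X x -> closed [set n | r <= re (x n)].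
  move=> Xx; have cl : closed [set s | r <= s] by exact: closed_ge.
  have /continuous_closedP/(_ _ cl) := re_character_continuous (t := 0) Xx.
  by congr closed; apply/seteqP; split=> n /=; rewrite subr0.
have C0 n : (forall p, C p n) -> n = 0.
  move=> nC; apply: contrapT => n0.
  have [x Xx] := continuous_characters_separate (R := R) hausN compN n0; apply.
  apply: re_eq1; apply/eqP; rewrite eq_le re_le1 /= leNgt; apply/negP => lt1.
  have := nC (SigSub (mem_set Xx), Num.truncn (1 - re (x n))^-1).
  rewrite /C /= leNgt => /negP; apply; rewrite ltrBrDr addrC -ltrBrDr.
  rewrite -[ltRHS]invrK ltf_pV2 ?posrE ?invr_gt0 ?subr_gt0 //; exact: truncnS_gt.
exists (N -> circle (R := R)), J, M; split.
- move=> i [x0 Xx0 x0i]; split.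
  + apply: subgroupI => [x Xx _|n n' Mn Mn' x Xx xi]; first exact: continuous_character_val0.
    by have [xB _] := Xx; rewrite xB Mn // Mn' // subrr.
  + have -> : M i = \bigcap_(x in X `&` [set x | f x i = 0]) [set n | 1 <= re (x n)].
      apply/seteqP; split=> [n Mn x [Xx xi] /=|n Mn x Xx xi]; first by rewrite Mn // re0.
      by apply/re_eq1/eqP; rewrite eq_le re_le1; exact: (Mn x).
    by apply: closed_bigI => x [Xx _]; exact: clre.
  + have [n nx] := kronecker compN subX (fun x (Xx : X x) => Xx)
      (fun x y Xx Xy => congr1 (fun g => g i) (fB x y Xx Xy)).
    exists n; first by move=> x Xx xi; rewrite nx.
    by move=> n0; apply: x0i; rewrite -nx // n0; exact: continuous_character_val0.
- move=> U; rewrite nbhsE => -[O [oO O0] OU].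
  have [p|n [_ nC]|s sO] := @compact_closed_family N _ C [set: N] O compN _ oO.
  + by apply: clre; exact: set_valP.
  + by rewrite (C0 n) // => p; exact: nC.
  apply: (@sub_finite_set _ _ [set i | exists2 p, p \in s & f (val p.1) i <> 0]).
    move=> i [_ nM] /=; apply: contrapT => ns; apply: nM => n Mn; apply/OU/sO; split=> //.
    elim: (s) ns => //= p t IH ns; split.
      rewrite /C /= Mn ?re0; [by rewrite gerBl invr_ge0|exact: set_valP|].
      by apply: contrapT => pi; apply: ns; exists p; rewrite ?mem_head.
    by apply: IH => -[q qt qi]; apply: ns; exists q; rewrite // inE qt orbT.
  elim: (s) => [|p t IH]; first by apply: (@sub_finite_set _ _ set0) => // i [].
  apply: (@sub_finite_set _ _ ([set i | f (val p.1) i <> 0] `|`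
      [set i | exists2 q, q \in t & f (val q.1) i <> 0])).
    by move=> i [q]; rewrite inE => /predU1P[->|qt] qi; [left|right; exists q].
  by rewrite finite_setU; split=> //; apply: ffin; exact: set_valP.
- move=> T S Sinf JS.
  have XS : X #<= S.
    apply: card_le_finite_support Sinf countable_circle_hull ffin fD _ JS => x y Xx Xy fxy.
    apply/eqP; rewrite -subr_eq0; apply/eqP/f0; first exact: subgroupB.
    by rewrite fB // fxy subrr.
  pose D (p : (N -> circle (R := R)) * nat) : set N := [set n | 1 - p.2.+1%:R^-1 < re (p.1 n)].
  exists [set D p | p in X `*` [set: nat]]; split.
  + apply: card_le_trans (card_image_le _ _) _.
    exact: card_le_trans (card_le_setX XS (card_lexx _)) (infinite_absorbs_nat Sinf).
  + move=> _ [[x k] [/= [_ Xx] _] <-].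
    have k0 : 0 < k.+1%:R^-1 :> R by rewrite invr_gt0.
    by apply: filterS (Xx _ k0) => n /=; rewrite ltrBlDr -ltrBlDl.
  + move=> n nD; apply: C0 => p; apply: ltW.
    by apply: (nD (D (val p.1, p.2))); exists (val p.1, p.2) => //; split=> //; exact: set_valP.
Qed.

(** * Locally compact groups *)

Section null_families.
Context {K : topologicalZmodType} (G : set K) (subG : subgroup G).

Definition null_family I (J : set I) (g : I -> K) :=
  (forall i, J i -> G (g i) /\ g i <> 0) /\
  forall U, nbhs (0 : K) U -> finite_set (J `&` g @^-1` (~` U)).

Lemma nondiscrete_subgroup (U : set K) : ~ discrete_space G -> nbhs (0 : K) U ->
  exists g, [/\ G g, U g & g <> 0].
Proof.
move=> ndG U0; apply: contrapT => noU; apply: ndG => x.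
have nx : nbhs x [set x].
  have : nbhs x ((val : G -> K) @^-1` ((fun y => y - val x) @^-1` U)).
    apply: (@initial_continuous G K val).
    by apply: (@shift_continuous K (- val x) (val x)); rewrite subrr.
  apply: filterS => y /= Uyx; apply/val_inj/eqP; rewrite -subr_eq0; apply/eqP.
  apply: contrapT => yx; apply: noU; exists (val y - val x); split=> //.
  by apply: subgroupB => //; exact: set_valP.
apply/seteqP; split=> A.
  by move=> /nbhs_singleton Ax; apply/principal_filterP.
by move=> /principal_filterP Ax; apply: filterS nx => _ ->.
Qed.

(** Pick a nonzero element of [G] in the intersection of the first [n] basic sets. *)
Lemma countable_null_family B : ~ discrete_space G -> local_basis (0 : K) B -> countable B ->
  exists g, null_family [set: nat] g.
Proof.
move=> ndG [Bo B0] Bc; have [c [_ cinj]] := card_le_fun 0%N Bc.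
pose W n := [set x : K | forall b, B b -> (c b <= n)%N -> b x].
have one n : nbhs (0 : K) [set x | forall b, B b -> c b = n -> b x].
  have [[b [Bb cb]]|nob] := pselect (exists b, B b /\ c b = n).
    have : nbhs (0 : K) b by apply: open_nbhs_nbhs; exact: Bo.
    by apply: filterS => x bx b' Bb' cb'; rewrite (cinj b' b) // cb'.
  by apply: filterS (@filterT _ (nbhs (0 : K)) _) => x _ b Bb cb; case: nob; exists b.
have nW n : nbhs (0 : K) (W n).
  elim: n => [|n IH].
    by apply: filterS (one 0%N) => x Wx b Bb; rewrite leqn0 => /eqP; exact: Wx.
  apply: filterS (filterI IH (one n.+1)) => x [Wx Wx'] b Bb; rewrite leq_eqVlt => /predU1P[|].
    exact: Wx'.
  exact: Wx.
have /choice[g gP] n := nondiscrete_subgroup ndG (nW n).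
exists g; split=> [n _|U /B0[b Bb bU]]; first by have [] := gP n.
apply: (@sub_finite_set _ _ `I_(c b)); last exact: finite_II.
move=> n [_ /= nU]; rewrite ltnNge; apply/negP => cbn; apply: nU; apply: bU.
by have [_ Wg _] := gP n; exact: Wg.
Qed.

End null_families.

Section locally_compact_groups.
Context {K : topologicalZmodType} (G : set K).
Hypotheses (hausK : hausdorff_space K) (lcK : locally_compact [set: K]).
Hypotheses (subG : subgroup G) (leG : locally_essential G).

(** A subgroup [M i] of [N] is compact, hence closed in [K], so that local essentiality
applies to it.  The neighbourhoods isolating [0] in [N] extend to closed
neighbourhoods in [K]; together with the countably many sets cutting out [N] they
isolate [0] in [K]. *)
Lemma locally_essential_null_family : exists I (J : set I) (g : I -> K),
  null_family G J g /\ forall T (S : set T), infinite_set S -> J #<= S ->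
    exists2 B, local_basis (0 : K) B & B #<= S.
Proof.
have [V V0 essG] := leG.
have [U [Ucl U0 subN NV]] := small_compact_subgroup hausK lcK V0.
set N := \bigcap_n U n in subN NV; pose H := subgroup_type subN.
have cN : compact N.
  apply: subclosed_compact U0 _; last by move=> x /(_ 0%N I).
  by apply: closed_bigI => n _; have [] := Ucl n.
have hausH : hausdorff_space H by exact: hausdorff_set_type.
have compH : compact [set: H] by exact: compact_set_type.
have valc : continuous (val : H -> K) by exact: (@initial_continuous N K val).
have [I [J [M [Msub Mnull Mbasis]]]] :=
  compact_null_subgroups Rdefinitions.RbaseSymbolsImpl.R hausH compH.
pose g0 i := fun x : K => [/\ G x, ((val : H -> K) @` M i) x & x <> 0].
have /choice[g gP] i : exists x, J i -> g0 i x.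
  have [Ji|nJi] := pselect (J i); last by exists 0.
  have [subM clM [n Mn n0]] := Msub _ Ji; apply: contrapT => nog.
  have M0 : (val : H -> K) @` M i = [set 0].
    apply: essG.
    - apply: subgroupI => [|_ _ [a Ma <-] [b Mb <-]]; first by exists 0 => //; exact: subgroup0.
      by exists (a - b) => //; exact: subgroupB.
    - apply: compact_closed => //; apply: continuous_compact; first exact: continuous_subspaceT.
      exact: subclosed_compact clM compH _.
    - by move=> _ [a _ <-]; apply: NV; exact: set_valP.
    - apply/seteqP; split=> [x [Gx Mx]|_ ->].
        by apply: contrapT => x0; apply: nog; exists x => _.
      split; first exact: subgroup0.
      by exists 0 => //; exact: subgroup0.
  apply: n0; apply/val_inj; rewrite -[RHS]/(0 : K).
  have : ((val : H -> K) @` M i) (val n) by exists n.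
  by rewrite M0.
exists I, J, g; split.
  split=> [i /gP[]//|W W0].
  have : nbhs (0 : H) ((val : H -> K) @^-1` W) by exact: valc.
  move=> /Mnull; apply: sub_finite_set => i [Ji /= nW]; split=> // MW; apply: nW.
  by have [_ [n Mn <-] _] := gP _ Ji; exact: MW.
move=> T S Sinf JS; have [DD [DDS DD0 DDI]] := Mbasis _ _ Sinf JS.
have /choice[ext extP] D : exists C : set K, DD D ->
    [/\ closed C, nbhs (0 : K) C & forall n : H, C (val n) -> D n].
  have [DDD|nD] := pselect (DD D); last by exists set0.
  have := DD0 _ DDD; rewrite nbhsE => -[_ [[W oW <-] W0] WD].
  have [|C [clC C0] CW] := @locally_compact_regular K hausK lcK W; first exact: open_nbhs_nbhs.
  by exists C => _; split=> // n /CW; exact: WD.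
apply: (@local_basis_of_closed_nbhs _ _ (range U `|` ext @` DD) (U 0%N)) => //.
- apply: card_le_setU => //; first exact: card_setX_le.
    by apply: card_le_trans (card_image_le _ _) _; exact/infiniteP.
  exact: card_le_trans (card_image_le _ _) DDS.
- by move=> C [[n _ <-]//|[D /extP[clC C0 _] <-]].
- by left; exists 0%N.
- move=> x xC.
  have Nx : N x by move=> n _; apply: xC; left; exists n.
  pose n : H := SigSub (mem_set Nx).
  suff n0 : n = 0 by exact: (congr1 (val : H -> K) n0).
  apply: DDI => D DDD; have [_ _ extD] := extP _ DDD.
  by apply/extD/(xC (ext D)); right; exists D.
Qed.

Hypothesis ndG : ~ discrete_space G.

Lemma locally_essential_super_sequence : exists S : set K,
  [/\ S `<=` G, infinite_set S, super_sequence_to S 0 &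
      exists2 B, local_basis (0 : K) B & B #<= S].
Proof.
have fam I (J : set I) g : null_family G J g -> infinite_set J -> exists S : set K,
    [/\ S `<=` G, infinite_set S, super_sequence_to S 0 & J #<= S].
  move=> [gG gnull] Jinf.
  have [|Sinf S0 JS] := null_family_super_sequence hausK Jinf _ gnull; first by move=> i /gG[].
  by exists (0 |` g @` J); split=> // x [->|[i /gG[Gg _] <-]] //; exact: subgroup0.
have [I [J [g [gJ basis]]]] := locally_essential_null_family.
have [Jfin|Jinf] := pselect (finite_set J); last first.
  have [S [SG Sinf S0 JS]] := fam _ _ _ gJ Jinf.
  by exists S; split=> //; exact: basis.
have [B B0 Bc] := basis _ _ infinite_nat (finite_set_countable Jfin).
have [h hnull] := countable_null_family subG ndG B0 Bc.
have [S [SG Sinf S0 JS]] := fam _ _ _ hnull infinite_nat.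
by exists S; split=> //; exists B => //; exact: card_le_trans Bc JS.
Qed.

End locally_compact_groups.

Theorem theorem7p2 (K : topologicalZmodType) (G : set K)
    (hausdorffK : hausdorff_space K)
    (lcK : locally_compact [set: K])
    (subG : subgroup G)
    (ndG : ~ discrete_space G)
    (leG : locally_essential G) :
  (exists S : set K,
     [/\ S `<=` G, super_sequence_to S 0 & is_character K S]) /\
  (exists (T U : Type) (A : set T) (B : set U),
     [/\ is_character G A, is_succ_card A B & is_super_sequence_card G B]).
Proof.
have [S [SG Sinf S0 [B B0 BS]]] :=
  locally_essential_super_sequence hausdorffK lcK subG leG ndG.
have basK (x : K) : exists2 C, local_basis x C & C #<= S.
  exists [set (fun y => y - x) @^-1` b | b in B]; first exact: local_basis_translate.
  exact: card_le_trans (card_image_le _ _) BS.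
split.
  exists S; split=> //; apply: is_character_super_sequence => //.
  by exists S, 0; split.
have basG (x : G) : exists2 C, local_basis x C & C #<= S.
  have [C xC CS] := basK (val x).
  exists [set (val : G -> K) @^-1` b | b in C]; first exact: local_basis_subspace.
  exact: card_le_trans (card_image_le _ _) CS.
have seqG : exists (S' : set G) x, super_sequence_to S' x /\ S #<= S'.
  have [_ _ Sfin] := super_sequence_sub S0.
  pose z : G := SigSub (mem_set (subgroup0 subG)).
  have SS' : S #<= (val : G -> K) @^-1` S.
    apply/card_le_relP; exists (fun x y => x = val y); split=> [x Sx|x x' y -> ->//].
    by exists (SigSub (mem_set (SG _ Sx))).
  exists ((val : G -> K) @^-1` S), z; split=> //; apply: super_sequence_toI.
  - exact: hausdorff_set_type.
  - by have [] := super_sequence_sub S0.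
  - by move=> /(card_le_finite SS').
  - move=> U; rewrite nbhsE => -[_ [[W oW <-] Wz] WU].
    apply: (@sub_finite_set _ _ ((val : G -> K) @^-1` (S `\` W))).
      by move=> x [Sx nU]; split=> // Wx; exact/nU/WU.
    apply: finite_preimage; first by move=> ? ? _ _; exact: val_inj.
    by apply: Sfin; exact: open_nbhs_nbhs.
have [C SC] := succ_card_exists S.
exists K, (set K), S, C; split=> //.
  exact: is_character_super_sequence.
exact: is_super_sequence_card_succ SC.
Qed.
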